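(* Suppose that complex numbers $a_n$, supported on $M < n < M+N$, satisfy \[ \sum_n|a_n|^2 \leqslant 1 , \quad \sum_{n\equiv 0(\mod p)}|a_n|^2\leqslant \frac{1}{p}\Bigl(\frac{\log p}{\log N}\Bigr)^2 \] for every prime $p$. Then \[ \sum_{q\leqslant Q}\, \sum^{*}_{\chi(\mod q)}\Bigl|\sum_{M<n\leqslant M+N}a_n\chi(n)\Bigr|^2 \leqslant 24 N(\log N/Q^2)^{-1} \] if $8Q^2\leqslant N$.
   Context: Here $\sum^{*}_{\chi(\mod q)}$ denotes summation over primitive Dirichlet characters modulo $q$. *)

(* Defs.v *)
From mathcomp Require Import all_boot all_order all_algebra.
From mathcomp Require Import complex.
From mathcomp Require cyclic.
From mathcomp Require Import all_classical all_reals all_analysis.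

Set Implicit Arguments.
Unset Strict Implicit.
Unset Printing Implicit Defensive.

Import Order.TTheory GRing.Theory Num.Theory.

Local Open Scope classical_set_scope.
Local Open Scope ring_scope.

(* chi 1 = 1 follows from the first and third clauses. For q = 1 the third    *)
(* clause also covers n = 0, so the only character is the constant 1.         *)
Definition dirichlet_character (R : realType) (q : nat) (chi : int -> R[i]) :=
  [/\ forall m n : int, chi (m * n) = chi m * chi n,
      forall n : int, chi (n + q%:Z) = chi n
    & forall n : int, (chi n != 0) = coprimez n q%:Z].

Definition induces (R : realType) (d q : nat) (psi chi : int -> R[i]) :=
  [/\ (d %| q)%N, dirichlet_character d psi
    & forall n : int, coprimez n q%:Z -> chi n = psi n].

Definition primitive_character (R : realType) (q : nat) (chi : int -> R[i]) :=
  dirichlet_character q chi /\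
  forall (d : nat) (psi : int -> R[i]), (d < q)%N -> ~ induces d q psi chi.

(* Sums over a set are finitely supported big operators, equal to 0 when the  *)
(* support is infinite; the next lemma shows that the sum over the primitive  *)
(* characters modulo q > 0 is a genuine finite sum.                           *)
Lemma finite_dirichlet_character (R : realType) (q : nat) : (0 < q)%N ->
  finite_set [set chi : int -> R[i] | dirichlet_character q chi].
Proof.
move=> q0.
have t0 : (0 < totient q)%N by rewrite totient_gt0.
have [s sE] : {s : seq R[i] | forall x, x ^+ totient q = 1 -> x \in s}.
  have [s ps] := closed_field_poly_normal ('X^(totient q) - 1%:P : {poly R[i]}).
  exists s => x x1.
  have : root ('X^(totient q) - 1%:P : {poly R[i]}) x.
    by rewrite /root !hornerE x1 subrr.
  rewrite ps rootZ ?root_prod_XsubC// lead_coefDl ?lead_coefXn ?oner_eq0//.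
  by rewrite size_polyXn size_polyN size_polyC oner_eq0.
have qn0 : q%:Z != 0 by rewrite eqz_nat -lt0n.
have modq (n : int) : (`|(n %% q%:Z)%Z|%N < q)%N.
  by rewrite -ltz_nat gez0_abs ?modz_ge0// ltz_pmod.
pose F (g : {ffun 'I_q -> seq_sub (0 :: s)}) (n : int) : R[i] :=
  val (g (Ordinal (modq n))).
apply: (@sub_finite_set _ _ (F @` setT)); last first.
  by apply: finite_image; exact: finite_finset.
move=> chi [/= chiM chiD chi0].
have chiDn (n : int) (k : nat) : chi (n + (k * q)%N%:Z) = chi n.
  by elim: k => [|k IH]; rewrite ?addr0// mulSn addnC PoszD addrA chiD.
have chi_mod (n : int) : chi n = chi (n %% q%:Z)%Z.
  rewrite {1}(divz_eq n q%:Z) addrC.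
  case: (n %/ q%:Z)%Z => k; first by rewrite -PoszM chiDn.
  by rewrite NegzE mulNr -PoszM -(chiDn (_ - _) k.+1) subrK.
have chi1 : chi 1 = 1.
  have nz : chi 1 != 0 by rewrite chi0 coprimezE coprime1n.
  by apply: (mulfI nz); rewrite -chiM !mulr1.
have chiX (n k : nat) : chi (n ^ k)%N%:Z = chi n%:Z ^+ k.
  by elim: k => [|k IH]; rewrite ?expn0// expnS PoszM chiM IH exprS.
have inS (n : nat) : chi n%:Z \in 0 :: s.
  rewrite inE; case: eqVneq => //= nz; apply: sE.
  have cop : coprime n q by move: nz; rewrite chi0 coprimezE.
  rewrite -chiX chi_mod modz_nat
    (cyclic.Euler_exp_totient cop) -modz_nat -chi_mod.
  exact: chi1.
exists [ffun i : 'I_q => SeqSub (inS i)] => //.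
apply/funext => n; rewrite /F ffunE /= gez0_abs ?modz_ge0//.
Qed.

(* Main.v *)
(* The multiplicative large sieve, applied to coefficients supported on integers
   free of prime factors up to z, gains a factor sum_r 1 / phi(r) >= log z
   over the moduli k = q r, because the Gauss sum of a primitive character
   mod q at level q r has modulus sqrt q on integers prime to r.  Split a_n
   according to the size of its smallest prime factor at the points
   exp(x / 4^j), x = log(N / Q^2) / 6.  The hypothesis on multiples of p and
   sum_(p <= e^y) log^2 p / p <= 2 y^2 bound the mass of a_n with a prime factor
   up to e^y by 2 y^2 / log^2 N, so the losses over the blocks form a convergent
   geometric series.  When log(N / Q^2) <= 19 the plain large sieve suffices. *)

Require Import Defs.
From mathcomp Require Import all_boot all_order all_algebra.
From mathcomp Require Import complex.
From mathcomp Require Import all_classical all_reals all_analysis.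
From mathcomp Require Import zify ring lra.

Set Implicit Arguments.
Unset Strict Implicit.
Unset Printing Implicit Defensive.

Import Order.TTheory GRing.Theory Num.Theory.
Import Normc numFieldNormedType.Exports.

Local Open Scope classical_set_scope.
Local Open Scope ring_scope.

(** One Bessel-type inequality of Selberg is used twice: for the additive large sieve at the
    fractions c/k, and for the passage from these fractions to characters. In the second use the
    vectors are indexed by a character and a cofactor r. Primitivity makes different characters at
    one level k orthogonal, so each vector has weight phi(k) only, even though many pairs (q, r)
    share the same k. The cofactors r must be prime to q, which alone would lose a factor phi(q)/q;
    the square modulus q of the Gauss sum, divided by phi(q), restores it. The ratio 4 between cut
    points comes from |x + y|^2 <= 2|x|^2 + 2|y|^2: every split doubles what remains, while the cost
    of a block is proportional to its logarithmic size, so the series has ratio 2/4. With L =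
    log(N/Q^2), the choice x = L/6 is close to L/sqrt 32, the minimum of 2/x + 64x/L^2. It gives
    68/(3L), while the moduli reach only Q e^x, so that Q^2 e^(2x) is small against N once L >
    19. *)

(** * Selberg's inequality *)

(** A weighted Bessel inequality. Let [T] be the left side and [v] the combination of the rows [c s]
    with coefficients [x s]. The square norm of [conj a - v] equals [|a|^2 - 2 T + |v|^2], and
    [|v|^2 <= T], whence [T <= |a|^2]. *)
Lemma selberg_inequality_closed (C : numClosedFieldType) (I : eqType) (J : Type)
    (ss : seq I) (js : seq J) (c : I -> J -> C) (a : J -> C) (w : I -> C) :
  {in ss, forall s, 0 < w s} ->
  {in ss, forall s,
    \sum_(t <- ss) `|\sum_(j <- js) c s j * (c t j)^*| <= w s} ->
  \sum_(s <- ss) `|\sum_(j <- js) a j * c s j| ^+ 2 / w s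
    <= \sum_(j <- js) `|a j| ^+ 2.
Proof.
move=> w_gt0 w_ge.
pose S s := \sum_(j <- js) a j * c s j.
pose x s := (S s)^* / w s.
pose v j := \sum_(s <- ss) x s * c s j.
pose K s t : C := `|\sum_(j <- js) c s j * (c t j)^*|.
set T := (X in X <= _).
have KC s t : K s t = K t s.
  rewrite /K -(norm_conjC (\sum_(j <- js) c s j * _)) rmorph_sum /=.
  by congr `|_|; apply: eq_bigr => j _; rewrite rmorphM /= conjCK mulrC.
have TE : T = \sum_(j <- js) a j * v j.
  under [RHS]eq_bigr do rewrite mulr_sumr.
  rewrite exchange_big /=; apply: eq_bigr => s _.
  under eq_bigr do rewrite mulrCA.
  rewrite -mulr_sumr normCK -/(S s) /x. ring.
have T_ge0 : 0 <= T.
  rewrite /T big_seq; apply: sumr_ge0 => s /w_gt0 ws.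
  by rewrite divr_ge0 ?exprn_ge0 // ltW.
have TJ : T^* = T by apply/CrealP/ger0_real.
have VE : \sum_(j <- js) `|v j| ^+ 2 =
    \sum_(s <- ss) \sum_(t <- ss)
       x s * (x t)^* * \sum_(j <- js) c s j * (c t j)^*.
  under eq_bigr do rewrite normCK /v rmorph_sum /= big_distrlr.
  rewrite exchange_big /=; apply: eq_bigr => s _.
  rewrite exchange_big /=; apply: eq_bigr => t _.
  by rewrite mulr_sumr; apply: eq_bigr => j _; rewrite rmorphM /= mulrACA.
have VT : \sum_(j <- js) `|v j| ^+ 2 <= T.
  rewrite -(ger0_norm (_ : 0 <= \sum_(j <- js) `|v j| ^+ 2)); last first.
    by apply: sumr_ge0 => j _; rewrite exprn_ge0.
  rewrite VE.
  (* Schur's test: [|x s| |x t|] is at most half the sum of the squares, and the symmetry of [K]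
     turns both halves into row sums bounded by [w s]. *)
  apply: (@le_trans _ _ (\sum_(s <- ss) \sum_(t <- ss)
     ((`|x s| ^+ 2 * K s t) / 2 + (`|x t| ^+ 2 * K t s) / 2))).
    apply: (le_trans (ler_norm_sum _ _ _)); apply: ler_sum => s _.
    apply: (le_trans (ler_norm_sum _ _ _)); apply: ler_sum => t _.
    rewrite normrM -/(K s t) (KC t s) (normrM (x s)) (norm_conjC (x t)).
    rewrite [leRHS](_ : _ = (`|x s| ^+ 2 + `|x t| ^+ 2) / 2 * K s t);
      last by ring.
    rewrite ler_wpM2r ?normr_ge0 // ler_pdivlMr // mulr_natr.
    rewrite -subr_ge0 addrAC -sqrrB real_exprn_even_ge0 ?rpredB ?normr_real //.
  under eq_bigr do rewrite big_split /=.
  rewrite big_split /= [X in _ + X]exchange_big /=.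
  rewrite -big_split /= /T big_seq [leRHS]big_seq; apply: ler_sum => s sin.
  rewrite -mulr_suml -splitr -mulr_sumr.
  have ws := w_gt0 _ sin.
  apply: (@le_trans _ _ (`|x s| ^+ 2 * w s)).
    by rewrite ler_wpM2l ?exprn_ge0 // w_ge.
  rewrite /x normrM norm_conjC normfV (gtr0_norm ws) -/(S s).
  by rewrite exprMn exprVn (expr2 (w s)) invfM -!mulrA mulVf ?mulr1 ?gt_eqF.
have : 0 <= \sum_(j <- js) `|(a j)^* - v j| ^+ 2.
  by apply: sumr_ge0 => j _; rewrite exprn_ge0.
have -> : \sum_(j <- js) `|(a j)^* - v j| ^+ 2 =
    \sum_(j <- js) `|a j| ^+ 2 - T - T + \sum_(j <- js) `|v j| ^+ 2.
  rewrite -{2}TJ TE rmorph_sum /= -!sumrB -big_split /=.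
  apply: eq_bigr => j _; rewrite !normCK rmorphB rmorphM /= conjCK; ring.
move=> h; rewrite -subr_ge0; apply: (le_trans h).
by rewrite -addrA gerDl addrC subr_le0.
Qed.


Lemma norm_normc (R : realType) (z : R[i]) : `|z| = (normc z)%:C%C.
Proof. by []. Qed.

Lemma normc_ge0 (R : realType) (z : R[i]) : 0 <= normc z.
Proof. by rewrite -lecR -norm_normc normr_ge0. Qed.

Lemma selberg_inequality (R : realType) (I : eqType) (J : Type)
    (ss : seq I) (js : seq J) (c : I -> J -> R[i]) (a : J -> R[i])
    (w : I -> R) :
  {in ss, forall s, 0 < w s} ->
  {in ss, forall s,
    \sum_(t <- ss) normc (\sum_(j <- js) c s j * (c t j)^*) <= w s} ->
  \sum_(s <- ss) normc (\sum_(j <- js) a j * c s j) ^+ 2 / w s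
    <= \sum_(j <- js) normc (a j) ^+ 2.
Proof.
move=> w_gt0 w_ge.
have := @selberg_inequality_closed _ I J ss js c a (fun s => (w s)%:C%C).
rewrite -lecR !rmorph_sum /=.
under [X in _ -> _ -> is_true (_ <= X)]eq_bigr do rewrite norm_normc -rmorphXn.
under [X in _ -> _ -> is_true (X <= _)]eq_bigr do
  rewrite norm_normc -rmorphXn -fmorphV -rmorphM.
apply => s /[dup] sin.
- by move=> /w_gt0; rewrite -ltcR.
- move=> /w_ge; rewrite -lecR rmorph_sum /=.
  by under eq_bigr do rewrite -norm_normc.
Qed.

(** * Moduli in [R[i]] and the additive character *)

Lemma normcX (R : realType) (z : R[i]) n : normc (z ^+ n) = normc z ^+ n.
Proof. by elim: n => [|n IH]; rewrite ?normc1 // !exprS normcM IH. Qed.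

Lemma normc_conj (R : realType) (z : R[i]) : normc z^* = normc z.
Proof. by case: z => x y /=; rewrite sqrrN. Qed.

Lemma conj_eqV (R : realType) (z : R[i]) : normc z = 1 -> z^* = z^-1.
Proof. by move=> z1; rewrite invC_norm norm_normc z1 expr1n invr1 mul1r. Qed.

Lemma normc_nat (R : realType) n : normc (n%:R : R[i]) = n%:R.
Proof. by rewrite normcMn normc1. Qed.

(** Concavity of the sine: were [sin y] below the chord, the mean value theorem on both sides of [y]
    would give [c1 < c2] with [cos c1 < 2 / pi < cos c2], although the cosine decreases. *)
Lemma jordan_sin (R : realType) (y : R) :
  0 <= y <= pi / 2 -> y * (2 / pi) <= sin y.
Proof.
move=> /andP[y0 ypi].
have pi0 : 0 < pi :> R by exact: pi_gt0.
have [->|yn0] := eqVneq y 0; first by rewrite mul0r sin0.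
have [->|ynpi] := eqVneq y (pi / 2).
  by rewrite sin_pihalf mulrC mulrA divfK ?divff // ?gt_eqF.
have {y0 yn0}y0 : 0 < y by rewrite lt_neqAle eq_sym yn0.
have {ypi ynpi}ypi : y < pi / 2 by rewrite lt_neqAle ynpi.
rewrite leNgt; apply/negP => lt_sin.
have sinc (a b : R) : {within `[a, b], continuous sin}.
  exact/continuous_subspaceT/continuous_sin.
have [c1 c1I e1] := MVT y0 (fun x _ => is_derive_sin x) (sinc 0 y).
have [c2 c2I e2] := MVT ypi (fun x _ => is_derive_sin x) (sinc y (pi / 2)).
move: c1I c2I; rewrite !in_itv /= => /andP[c10 c1y] /andP[yc2 c2pi].
have : cos c2 < cos c1.
  rewrite ltr_cos ?in_itv /=; first exact: lt_trans yc2.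
    by apply/andP; split; lra.
  by apply/andP; split; lra.
move: e1 e2; rewrite sin0 subr0 subr0 sin_pihalf => e1 e2.
have h1 : cos c1 < 2 / pi by rewrite -(ltr_pM2l y0) (mulrC _ (cos _)) -e1.
have h2 : 2 / pi < cos c2.
  have d0 : 0 < pi / 2 - y by rewrite subr_gt0.
  rewrite -(ltr_pM2r d0) -e2 mulrBr mulrA divfK ?gt_eqF // divff ?gt_eqF //.
  by rewrite ltrD2l ltrN2 mulrC.
by rewrite ltNge ltW // (lt_trans h1).
Qed.

(** The additive character e(x) = exp(2 pi i x). *)
Definition expi (R : realType) (x : R) : R[i] :=
  (cos (pi *+ 2 * x) +i* sin (pi *+ 2 * x))%C.

Lemma expi0 (R : realType) : expi (0 : R) = 1.
Proof. by rewrite /expi mulr0 cos0 sin0. Qed.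

Lemma expiD (R : realType) (x y : R) : expi (x + y) = expi x * expi y.
Proof.
rewrite /expi mulrDr cosD sinD; simpc; congr (_ +i* _)%C.
by rewrite addrC.
Qed.

Lemma expiN (R : realType) (x : R) : expi (- x) = (expi x)^*.
Proof. by rewrite /expi mulrN cosN sinN. Qed.

Lemma normc_expi (R : realType) (x : R) : normc (expi x) = 1.
Proof. by rewrite /= cos2Dsin2 sqrtr1. Qed.

Lemma expi_nat (R : realType) (n : nat) : expi (n%:R : R) = 1.
Proof.
elim: n => [|n IH]; first exact: expi0.
by rewrite -natr1 expiD IH mul1r /expi mulr1 cos2pi sin2pi.
Qed.

Lemma expi_int (R : realType) (m : int) : expi (m%:~R : R) = 1.
Proof.
by case: m => n; rewrite ?NegzE ?mulrNz ?expiN -?pmulrn expi_nat // rmorph1.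
Qed.

Lemma expiM (R : realType) (x : R) (n : nat) : expi (x * n%:R) = expi x ^+ n.
Proof.
elim: n => [|n IH]; first by rewrite mulr0 expi0.
by rewrite -natr1 mulrDr mulr1 expiD IH exprSr.
Qed.

Lemma normc_expi_sub1 (R : realType) (x : R) :
  normc (expi x - 1) ^+ 2 = (sin (pi * x) *+ 2) ^+ 2.
Proof.
rewrite /expi /= sqr_sqrtr ?addr_ge0 ?sqr_ge0 //.
have h := cos2Dsin2 (pi * x).
rewrite mulrnAl sin_mulr2n cos_mulr2n subr0.
rewrite (_ : cos (pi * x) ^+ 2 = 1 - sin (pi * x) ^+ 2); last first.
  by rewrite -h; ring.
transitivity ((cos (pi * x) ^+ 2 + sin (pi * x) ^+ 2) * sin (pi * x) ^+ 2 *+ 4).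
  by ring.
by rewrite h; ring.
Qed.

Lemma ge_normc_expi_sub1 (R : realType) (x : R) : 0 <= x <= 1 / 2 ->
  4 * x <= normc (expi x - 1).
Proof.
move=> /andP[x0 x1]; have pi0 := pi_gt0 R.
have h : x *+ 2 <= sin (pi * x).
  have := @jordan_sin R (pi * x); rewrite (_ : pi * x * (2 / pi) = x *+ 2).
    apply; rewrite mulr_ge0 ?(ltW pi0) //=.
    by rewrite ler_pM2l // -div1r.
  by move: (pi : R) pi0 => p p0; field; rewrite gt_eqF.
rewrite -(@ler_pXn2r _ 2) ?nnegrE ?normc_ge0 ?mulr_ge0 // normc_expi_sub1.
rewrite ler_pXn2r ?nnegrE ?mulr_ge0 ?mulrn_wge0 ?(le_trans _ h) ?mulrn_wge0 //.
lra.
Qed.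

(** * Well-spaced points and the additive large sieve *)

Lemma ler_sum_uniq_subset (R : numDomainType) (T : eqType) (s t : seq T)
    (F : T -> R) :
  uniq s -> uniq t -> {subset s <= t} -> (forall x, 0 <= F x) ->
  \sum_(x <- s) F x <= \sum_(x <- t) F x.
Proof.
move=> us ut st F0.
have /(perm_big _) -> /= : perm_eq s [seq x <- t | x \in s].
  apply: uniq_perm => //; first exact: filter_uniq.
  by move=> x; rewrite mem_filter andb_idr // => /st.
by rewrite big_filter big_mkcond /=; apply: ler_sum => x _; case: ifP.
Qed.

Lemma sum_inv_sqr_le2 (R : realType) (n : nat) :
  \sum_(i <- iota 1 n) (i%:R ^+ 2)^-1 <= 2 :> R.
Proof.
(* The bound [1/(m+1)^2 <= 1/m - 1/(m+1)] telescopes only if the inverse is kept on the right; the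
   range ends at [n.+1] so that this is never the inverse of 0. *)
suff h : \sum_(i <- iota 1 n.+1) (i%:R ^+ 2)^-1 <= 2 - n.+1%:R^-1 :> R.
  apply: (@le_trans _ _ (\sum_(i <- iota 1 n.+1) (i%:R ^+ 2)^-1)).
    apply: ler_sum_uniq_subset; rewrite ?iota_uniq //.
      by move=> i; rewrite !mem_iota; lia.
  by apply: (le_trans h); rewrite gerBl invr_ge0.
elim: n => [|n IH]; first by rewrite big_seq1 expr1n invr1; lra.
rewrite -(addn1 n.+1) iotaD big_cat /= big_seq1 add1n.
have n0 : 0 < n.+1%:R :> R by [].
apply: (le_trans (lerD IH (lexx _))).
rewrite addn1 -lerBrDl [leRHS](_ : _ = n.+1%:R^-1 - n.+2%:R^-1); last by ring.
rewrite -(natr1 n.+1).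
have n1 : 0 < n.+1%:R + 1 :> R by rewrite addr_gt0.
rewrite (_ : n.+1%:R^-1 - (n.+1%:R + 1)^-1 = ((n.+1%:R + 1) * n.+1%:R)^-1).
  by rewrite lef_pV2 ?posrE ?exprn_gt0 ?mulr_gt0 // expr2 ler_pM2l // lerDl.
by field; rewrite !gt_eqF.
Qed.

(** By the spacing, the integer parts of [K * g t] are distinct integers between 1 and [K], so the
    sum is dominated by [K^2] times the sum of the [1/i^2]. *)
Lemma spaced_sum_inv_sqr (R : realType) (T : eqType) (ts : seq T)
    (g : T -> R) (K : nat) : (0 < K)%N -> uniq ts ->
  {in ts, forall t, K%:R^-1 <= g t <= 1} ->
  {in ts &, forall s t, s != t -> K%:R^-1 <= `|g s - g t|} ->
  \sum_(t <- ts) (g t ^+ 2)^-1 <= 2 * K%:R ^+ 2.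
Proof.
move=> K0 uts gI gsp.
have K0R : 0 < K%:R :> R by rewrite ltr0n.
pose i t := Num.truncn (K%:R * g t).
have g0 t : t \in ts -> 0 < g t.
  by move=> /gI /andP[h _]; apply: lt_le_trans h; rewrite invr_gt0.
have iP t : t \in ts -> (i t)%:R <= K%:R * g t < (i t).+1%:R.
  by move=> /g0 gt0; apply: truncn_itv; rewrite mulr_ge0 // ltW.
have i1 t : t \in ts -> (0 < i t)%N.
  move=> tin; have /andP[_] := iP t tin.
  have /andP[h _] := gI t tin => h2.
  rewrite -ltnS -(ltr_nat R); apply: le_lt_trans h2.
  by rewrite -ler_pdivrMl // mulr1.
have iK t : t \in ts -> (i t <= K)%N.
  move=> tin; have /andP[h _] := iP t tin; have /andP[_ h2] := gI t tin.
  by rewrite -(ler_nat R); apply: (le_trans h); rewrite ger_pMr.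
have i_inj : {in ts &, injective i}.
  move=> s t sin tin eq_i; apply/eqP/negPn/negP => st.
  have := gsp s t sin tin st.
  rewrite leNgt => /negP; apply.
  rewrite -(ltr_pM2l K0R) divff ?gt_eqF //.
  rewrite -[X in X * `|_|](gtr0_norm K0R) -normrM.
  have /andP[s1 s2] := iP _ sin; have /andP[t1 t2] := iP _ tin.
  move: s1 s2; rewrite eq_i => s1 s2; rewrite -natr1 in s2 t2.
  by rewrite ltr_norml mulrBr; apply/andP; split; lra.
apply: (@le_trans _ _ (\sum_(t <- ts) K%:R ^+ 2 * ((i t)%:R ^+ 2)^-1)).
  rewrite big_seq [leRHS]big_seq; apply: ler_sum => t tin.
  have := i1 t tin; rewrite -(ltr0n R) => it0.
  have /andP[h _] := iP _ tin; have gt0 := g0 _ tin.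
  rewrite ler_pdivlMr ?exprn_gt0 // mulrC ler_pdivrMr ?exprn_gt0 //.
  by rewrite -exprMn ler_pXn2r ?nnegrE ?mulr_ge0 ?(ltW gt0).
rewrite -mulr_sumr mulrC ler_wpM2r ?sqr_ge0 //.
rewrite -(big_map i predT (fun n => (n%:R ^+ 2)^-1)) /=.
apply: le_trans (sum_inv_sqr_le2 R K).
apply: ler_sum_uniq_subset; rewrite ?iota_uniq ?map_inj_in_uniq //.
  by move=> _ /mapP[t tin ->]; rewrite mem_iota add1n ltnS i1 // iK.
Qed.

Lemma normc_geometric_le (R : realType) (z : R[i]) (n : nat) :
  normc z = 1 -> normc (z - 1) * normc (\sum_(j < n) z ^+ j) <= 2.
Proof.
move=> z1; rewrite -normcM -subrX1 (le_trans (le_normcD _ _)) //.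
by rewrite normcX z1 expr1n normcN normc1.
Qed.

(** On the left half of the interval [|e(x) - 1| >= 4 x], on the right half the same holds with
    [1 - x]. Adding the two bounds replaces the distance to the nearest integer by two one-sided
    distances, each handled by the spacing lemma. *)
Lemma le_inv_normc_expi_sub1 (R : realType) (x : R) : 0 < x < 1 ->
  4 / normc (expi x - 1) ^+ 2 <= ((x ^+ 2)^-1 + ((1 - x) ^+ 2)^-1) / 4.
Proof.
move=> /andP[x0 x1].
have half (y : R) : 0 < y <= 1 / 2 ->
    4 / normc (expi y - 1) ^+ 2 <= (y ^+ 2)^-1 / 4.
  move=> /andP[y0 y1]; have h : 4 * y <= normc (expi y - 1).
    by apply: ge_normc_expi_sub1; rewrite ltW.
  have p0 : 0 < normc (expi y - 1) by apply: lt_le_trans h; rewrite mulr_gt0.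
  rewrite ler_pdivrMr ?exprn_gt0 // mulrAC ler_pdivlMr //.
  rewrite [leRHS]mulrC ler_pdivlMr ?exprn_gt0 //.
  have -> : 4 * 4 * y ^+ 2 = (4 * y) ^+ 2 by ring.
  by rewrite ler_pXn2r ?nnegrE ?mulr_ge0 ?(ltW p0) ?(ltW y0).
have sym : normc (expi x - 1) = normc (expi (1 - x) - 1).
  have -> : expi (1 - x) = (expi x)^*.
    by rewrite expiD (expi_nat R 1) mul1r expiN.
  by rewrite -normc_conj rmorphB rmorph1.
have [xh|xh] := leP x (1 / 2).
  apply: (le_trans (half x _)); first by rewrite x0.
  by rewrite ler_wpM2r ?invr_ge0 // lerDl invr_ge0 sqr_ge0.
rewrite sym; apply: (le_trans (half (1 - x) _)).
  by apply/andP; split; lra.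
by rewrite ler_wpM2r ?invr_ge0 // lerDr invr_ge0 sqr_ge0.
Qed.

(** The cells counted form a parallelogram: each of the [K] rows carries the values [F 0], ...,
    [F n] once, shifted by the row index. *)
Lemma sum_diagonals (V : nmodType) (F : nat -> V) (K n : nat) :
  \sum_(p : 'I_K * 'I_(n + K))
     (if (p.1 <= p.2 < p.1 + n.+1)%N then F (p.2 - p.1)%N else 0) =
  (\sum_(j < n.+1) F j) *+ K.
Proof.
rewrite -(pair_bigA _ (fun (j : 'I_K) (m : 'I_(n + K)) =>
  if (j <= m < j + n.+1)%N then F (m - j)%N else 0)) /=.
rewrite -[in RHS](card_ord K) -sumr_const; apply: eq_bigr => j _.
rewrite -big_mkcond /= -(big_mkord (fun m => j <= m < j + n.+1)%N
  (fun m => F (m - j)%N)).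
have jK := ltn_ord j.
rewrite (eq_bigl (fun m => (j <= m)%N && (m < j + n.+1)%N)) //.
rewrite -(big_nat_widen _ _ _ (fun m => j <= m)%N); last by lia.
have := @big_nat_widenl _ _ _ j 0 (j + n.+1) predT (fun m => F (m - j)%N) isT.
rewrite /= => <-.
rewrite -{1}[nat_of_ord j]add0n big_addn addKn big_mkord.
by apply: eq_bigr => i _; rewrite addnK.
Qed.

(* Selberg's inequality is applied to K shifted copies of the exponential sum:
   the kernel becomes a product of two geometric sums and decays quadratically. *)
Lemma large_sieve_nat (R : realType) (T : eqType) (ts : seq T) (alpha : T -> R)
    (K n : nat) (b : nat -> R[i]) : (0 < K)%N -> uniq ts ->
  {in ts &, forall s t, s != t ->
     forall m : int, K%:R^-1 <= `|alpha s - alpha t - m%:~R|} ->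
  \sum_(t <- ts) normc (\sum_(j < n.+1) b j * expi (alpha t * j%:R)) ^+ 2
    <= (n + 2 * K)%:R * \sum_(j < n.+1) normc (b j) ^+ 2.
Proof.
move=> K0 uts spaced.
have K0R : 0 < K%:R :> R by rewrite ltr0n.
(* [p.1] is a shift and [p.2] a shifted position. Each row of [a] is a translate of [b], and against
   [c t] it reproduces the same exponential sum. *)
pose c t (p : 'I_K * 'I_(n + K)) := expi (alpha t * (p.2%:R - p.1%:R)).
pose a (p : 'I_K * 'I_(n + K)) :=
  if (p.1 <= p.2 < p.1 + n.+1)%N then b (p.2 - p.1)%N else 0.
(* The diagonal kernel contributes [K (n + K)]. Off the diagonal, two sums of inverse squares, each
   at most [2 K^2], enter with the factor 1/4 and add at most [K^2]. *)
pose w (t : T) : R := K%:R * (n + 2 * K)%:R.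
have w_gt0 t : 0 < w t by rewrite mulr_gt0 // ltr0n; lia.
have kernelE s t : \sum_p c s p * (c t p)^* =
    (\sum_(j < K) expi (- (alpha s - alpha t)) ^+ j) *
    (\sum_(m < n + K) expi (alpha s - alpha t) ^+ m).
  rewrite big_distrlr /= pair_bigA /=; apply: eq_bigr => p _.
  rewrite /c -expiN -!expiM -!expiD; congr expi; ring.
have kernel_diag s : normc (\sum_p c s p * (c s p)^*) = K%:R * (n + K)%:R.
  rewrite kernelE subrr oppr0 expi0.
  have sum1 m : \sum_(j < m) (1 : R[i]) ^+ j = m%:R.
    by under eq_bigr do rewrite expr1n; rewrite sumr_const card_ord.
  by rewrite !sum1 normcM !normc_nat.
have kernel_le s t (m : int) : 0 < alpha s - alpha t - m%:~R < 1 ->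
   normc (\sum_p c s p * (c t p)^*) <=
   (((alpha s - alpha t - m%:~R) ^+ 2)^-1 +
    ((1 - (alpha s - alpha t - m%:~R)) ^+ 2)^-1) / 4.
  move=> fI; apply: le_trans (le_inv_normc_expi_sub1 fI).
  rewrite kernelE.
  have -> : expi (alpha s - alpha t - m%:~R) = expi (alpha s - alpha t).
    by rewrite expiD expiN expi_int conjC1 mulr1.
  have z1 := normc_expi (alpha s - alpha t).
  have zN := expiN (alpha s - alpha t).
  have e1 : normc (expi (- (alpha s - alpha t)) - 1) =
      normc (expi (alpha s - alpha t) - 1).
    by rewrite -[RHS]normc_conj rmorphB rmorph1 zN.
  have z2 := normc_expi (- (alpha s - alpha t)).
  have h1 := normc_geometric_le K z2; have h2 := normc_geometric_le (n + K) z1.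
  rewrite e1 in h1.
  have p0 : 0 < normc (expi (alpha s - alpha t) - 1).
    rewrite lt_neqAle normc_ge0 andbT eq_sym; apply/eqP => e0.
    move: fI => /andP[f0 f1].
    have e0' : normc (expi (alpha s - alpha t - m%:~R) - 1) = 0.
      by rewrite expiD expiN expi_int conjC1 mulr1.
    have := normc_expi_sub1 (alpha s - alpha t - m%:~R).
    rewrite e0' expr0n /= => /esym/eqP; rewrite expf_eq0 /= mulrn_eq0 /=.
    rewrite gt_eqF // sin_gt0_pi // mulr_gt0 ?pi_gt0 //=.
    by rewrite gtr_pMr ?pi_gt0.
  rewrite normcM ler_pdivlMr ?exprn_gt0 //.
  have -> : 4 = 2 * 2 :> R by ring.
  rewrite [leLHS](_ : _ = (normc (expi (alpha s - alpha t) - 1) *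
    normc (\sum_(j < K) expi (- (alpha s - alpha t)) ^+ j)) *
    (normc (expi (alpha s - alpha t) - 1) *
     normc (\sum_(m0 < n + K) expi (alpha s - alpha t) ^+ m0))); last by ring.
  by apply: ler_pM; rewrite ?mulr_ge0 ?normc_ge0.
have w_ge : {in ts, forall s,
    \sum_(t <- ts) normc (\sum_p c s p * (c t p)^*) <= w s}.
  move=> s sin; rewrite (bigD1_seq s) //= kernel_diag.
  pose m t := Num.floor (alpha s - alpha t).
  pose f t := alpha s - alpha t - (m t)%:~R.
  have fsp t u : t \in ts -> u \in ts -> t != u -> K%:R^-1 <= `|f t - f u|.
    move=> tin uin tu; have := spaced u t uin tin _ (m t - m u).
    rewrite eq_sym tu => /(_ isT); congr (_ <= `|_|).
    by rewrite /f rmorphB /=; ring.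
  have fI t : t \in ts -> t != s -> K%:R^-1 <= f t <= 1 - K%:R^-1.
    rewrite eq_sym => tin ts'.
    have /andP[f0 f1] := floor_itv (alpha s - alpha t).
    have := spaced s t sin tin ts' (m t).
    rewrite ger0_norm; last by rewrite subr_ge0.
    move=> ->; have := spaced s t sin tin ts' (m t + 1).
    rewrite ler0_norm; last by rewrite subr_le0 ltW.
    by rewrite /f rmorphD /=; lra.
  have Ki : 0 < K%:R^-1 :> R by rewrite invr_gt0.
  pose ts' := [seq t <- ts | t != s].
  have uts' : uniq ts' by rewrite filter_uniq.
  have s1 : \sum_(t <- ts') (f t ^+ 2)^-1 <= 2 * K%:R ^+ 2.
    apply: spaced_sum_inv_sqr => //.
      move=> t; rewrite mem_filter => /andP[ts1 tin].
      by have /andP[-> h] := fI t tin ts1; lra.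
    move=> t u; rewrite !mem_filter => /andP[_ tin] /andP[_ uin].
    exact: fsp.
  have s2 : \sum_(t <- ts') ((1 - f t) ^+ 2)^-1 <= 2 * K%:R ^+ 2.
    apply: (@spaced_sum_inv_sqr _ _ _ (fun t => 1 - f t)) => //.
      move=> t; rewrite mem_filter => /andP[ts1 tin].
      by have /andP[h1 h2] := fI t tin ts1; apply/andP; split; lra.
    move=> t u; rewrite !mem_filter => /andP[_ tin] /andP[_ uin] tu.
    have := fsp u t uin tin; rewrite eq_sym => /(_ tu).
    by congr (_ <= `|_|); ring.
  have -> : w s = K%:R * (n + K)%:R + K%:R ^+ 2.
    by rewrite /w (natrD _ n (2 * K)) (natrM _ 2) (natrD _ n K); ring.
  rewrite lerD2l -big_filter -/ts'.
  apply: (@le_trans _ _ (\sum_(t <- ts')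
     ((f t ^+ 2)^-1 + ((1 - f t) ^+ 2)^-1) / 4)).
    rewrite big_seq [leRHS]big_seq; apply: ler_sum => t.
    rewrite mem_filter => /andP[ts1 tin]; apply: kernel_le.
    have /andP[h1 h2] := fI t tin ts1.
    by apply/andP; rewrite -/(f t); split; lra.
  by rewrite -mulr_suml big_split /=; lra.
have := selberg_inequality a (fun s _ => w_gt0 s) w_ge.
have -> : \sum_p normc (a p) ^+ 2 = K%:R * \sum_(j < n.+1) normc (b j) ^+ 2.
  rewrite mulr_natl -(sum_diagonals (fun j => normc (b j) ^+ 2)).
  apply: eq_bigr => p _.
  by rewrite /a; case: ifP; rewrite // normc0 expr0n.
under eq_bigr => s _.
  have -> : \sum_p a p * c s p =
      K%:R * \sum_(j < n.+1) b j * expi (alpha s * j%:R).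
    rewrite mulr_natl -(sum_diagonals (fun j => b j * expi (alpha s * j%:R))).
    apply: eq_bigr => p _.
    rewrite /a /c; case: ifP; rewrite ?mul0r // => /andP[le12 _].
    by rewrite natrB.
  rewrite normcM normc_nat exprMn /w.
  over.
rewrite -mulr_suml -mulr_sumr ler_pdivrMr ?mulr_gt0 ?ltr0n //; last by lia.
set A := (X in K%:R ^+ 2 * X); set B := \sum_(j < _) _.
rewrite [leRHS](_ : _ = K%:R ^+ 2 * ((n + 2 * K)%:R * B)); last by ring.
by rewrite ler_pM2l // exprn_gt0.
Qed.

(** * Lifting units, and elementary properties of Dirichlet characters *)

Lemma coprimez_congr (k m n : int) :
  (k %| m - n)%Z -> coprimez m k = coprimez n k.
Proof.
suff imp (x y : int) : (k %| x - y)%Z -> coprimez x k -> coprimez y k.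
  move=> kmn; apply/idP/idP; apply: imp => //.
  by rewrite -opprB rpredN.
move=> /dvdzP[t xy] /coprimezP[[u v] /= uv]; apply/coprimezP.
exists (u, v + u * t) => /=; rewrite -uv -[x](subrK y) xy; ring.
Qed.

(** The multiplier of [d] is the part of [q] built from primes not dividing [n]. A prime divisor of
    [q] then divides exactly one of the two summands: [n] when it divides [n], and the second one
    otherwise. This lifts units modulo [d] to units modulo [q]. *)
Lemma coprime_add_mul_partC (n d q : nat) : (0 < n)%N -> (0 < q)%N ->
  coprime n d -> coprime (n + d * q`_(negn \pi(n))) q.
Proof.
move=> n0 q0 nd; set t := (q`_(negn \pi(n)))%N; set g := gcdn (n + d * t) q.
rewrite /coprime -/g; case: (eqVneq g 1%N) => // g1.
have g0 : (0 < g)%N by rewrite gcdn_gt0 q0 orbT.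
have pp : prime (pdiv g) by rewrite pdiv_prime // ltn_neqAle eq_sym g1.
set p := pdiv g in pp.
have pn : (p %| n + d * t)%N by apply: dvdn_trans (pdiv_dvd g) (dvdn_gcdl _ _).
have pq : (p %| q)%N by apply: dvdn_trans (pdiv_dvd g) (dvdn_gcdr _ _).
have t0 : (0 < t)%N by rewrite part_gt0.
have [pdn|pdn] := boolP (p %| n)%N.
  move: pn; rewrite dvdn_addr // Euclid_dvdM // => /orP[pd|pt].
    move: nd; rewrite /coprime => /eqP nd.
    have : (p %| gcdn n d)%N by rewrite dvdn_gcd pdn.
    by rewrite nd dvdn1 => /eqP p1; rewrite p1 in pp.
  have := part_pnat (negn \pi(n)) q; rewrite -/t /pnat => /andP[_ /allP h].
  have /h : p \in primes t by rewrite mem_primes pp t0.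
  by rewrite inE /= /predC /= !inE mem_primes pp n0 pdn.
move: pn pdn; rewrite -(partnC (\pi(n)) q0) -/t in pq.
move: pq; rewrite Euclid_dvdM // => /orP[pt|pt]; last first.
  by rewrite dvdn_addl ?dvdn_mull // => ->.
have := part_pnat (\pi(n)) q; rewrite /pnat => /andP[_ /allP h].
have /h : p \in primes (q`_(\pi(n)))%N by rewrite mem_primes pp part_gt0.
by rewrite /= !inE mem_primes pp n0 /= => -> _.
Qed.

Lemma coprimez_lift (n : int) (d q : nat) : (0 < d)%N -> (0 < q)%N ->
  coprimez n d%:Z ->
  exists c : int, coprimez c q%:Z /\ (d%:Z %| c - n)%Z.
Proof.
move=> d0 q0 nd.
pose m := (`|(n %% d%:Z)%Z| + d)%N.
have mE : m%:Z = (n %% d%:Z)%Z + d%:Z.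
  by rewrite /m PoszD gez0_abs ?modz_ge0 // eqz_nat -lt0n.
have dm : (d%:Z %| m%:Z - n)%Z.
  rewrite mE {2}(divz_eq n d%:Z).
  apply/dvdzP; exists (1 - (n %/ d%:Z)%Z); ring.
exists (m + d * q`_(negn \pi(m)))%:Z; split.
  rewrite coprimezE !absz_nat; apply: coprime_add_mul_partC => //.
    by rewrite /m addn_gt0 d0 orbT.
  by have := coprimez_congr dm; rewrite nd coprimezE !absz_nat.
rewrite PoszD PoszM addrAC rpredD // dvdz_mulr //.
Qed.

Section DirichletCharacter.
Variables (R : realType) (q : nat) (chi : int -> R[i]).
Hypotheses (q_gt0 : (0 < q)%N) (chiP : dirichlet_character q chi).

Lemma dchar_mul m n : chi (m * n) = chi m * chi n.
Proof. by case: chiP. Qed.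

Lemma dchar_neq0 n : (chi n != 0) = coprimez n q%:Z.
Proof. by case: chiP. Qed.

Lemma dchar_eq0 n : ~~ coprimez n q%:Z -> chi n = 0.
Proof. by rewrite -dchar_neq0 negbK => /eqP. Qed.

Lemma dchar1 : chi 1 = 1.
Proof.
have nz : chi 1 != 0 by rewrite dchar_neq0 coprimezE coprime1n.
by apply: (mulfI nz); rewrite -dchar_mul !mulr1.
Qed.

Lemma dchar_congr m n : (q%:Z %| m - n)%Z -> chi m = chi n.
Proof.
have chiD : forall n, chi (n + q%:Z) = chi n by case: chiP.
have chiDn (x : int) (k : nat) : chi (x + k%:Z * q%:Z) = chi x.
  elim: k => [|k IH]; first by rewrite mul0r addr0.
  by rewrite -addn1 PoszD mulrDl mul1r addrA chiD.
move=> /dvdzP[k mn]; have -> : m = n + k * q%:Z by rewrite -mn addrC subrK.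
case: k mn => k _ //; rewrite NegzE -{2}[n](subrK (k.+1%:Z * q%:Z)) chiDn.
by rewrite mulNr.
Qed.

Lemma dchar_exp n k : chi (n ^+ k) = chi n ^+ k.
Proof.
elim: k => [|k IH]; first exact: dchar1.
by rewrite !exprS dchar_mul IH.
Qed.

Lemma normc_dchar n : coprimez n q%:Z -> normc (chi n) = 1.
Proof.
move=> nq; have t0 : (0 < totient q)%N by rewrite totient_gt0.
pose m := `|(n %% q%:Z)%Z|%N.
have mE : m%:Z = (n %% q%:Z)%Z.
  by rewrite gez0_abs // modz_ge0 // eqz_nat -lt0n.
have qm : (q%:Z %| m%:Z - n)%Z by rewrite mE -eqz_mod_dvd modz_mod.
have mq : coprime m q.
  by have := coprimez_congr qm; rewrite nq coprimezE !absz_nat.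
rewrite -(dchar_congr qm).
have : normc (chi m%:Z) ^+ totient q = 1.
  rewrite -normcX -dchar_exp.
  have -> : m%:Z ^+ totient q = (m ^ totient q)%N%:Z by rewrite -!natz natrX.
  rewrite (@dchar_congr _ 1) ?dchar1 ?normc1 //.
  by rewrite -eqz_mod_dvd !modz_nat cyclic.Euler_exp_totient.
by move/eqP; rewrite pexpr_eq1 ?normc_ge0 // => /eqP.
Qed.

End DirichletCharacter.

(** Otherwise [chi] would depend, on units modulo [q], only on the class modulo [d], and would be
    induced by a character modulo [d]. *)
Lemma primitive_character_witness (R : realType) (q d : nat)
    (chi : int -> R[i]) : (0 < q)%N -> primitive_character q chi ->
  (d %| q)%N -> (d < q)%N ->
  exists c : int, [/\ coprimez c q%:Z, (d%:Z %| c - 1)%Z & chi c != 1].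
Proof.
move=> q0 [chiP prim] dq ltdq; apply: contrapT => noc.
have d0 : (0 < d)%N by apply: dvdn_gt0 dq.
have qdvd (x : int) : (q%:Z %| x)%Z -> (d%:Z %| x)%Z by apply: dvdz_trans.
have chi_1 (c : int) : coprimez c q%:Z -> (d%:Z %| c - 1)%Z -> chi c = 1.
  move=> cq dc; apply/eqP/negPn/negP => c1; apply: noc.
  by exists c.
have chi_d (m n : int) : coprimez m q%:Z -> coprimez n q%:Z ->
    (d%:Z %| m - n)%Z -> chi m = chi n.
  move=> mq nq dmn; have /coprimezP[[u v] /= uv] := mq.
  have uq : coprimez u q%:Z.
    by apply/coprimezP; exists (m, v); rewrite /= mulrC.
  have um1 : chi (u * m) = 1.
    apply: chi_1; first by rewrite coprimezMl uq.
    apply: qdvd; apply/dvdzP; exists (- v); rewrite -uv; ring.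
  have un1 : chi (u * n) = 1.
    apply: chi_1; first by rewrite coprimezMl uq.
    have -> : u * n - 1 = (u * m - 1) - u * (m - n) by ring.
    rewrite rpredB ?dvdz_mull //.
    apply: qdvd; apply/dvdzP; exists (- v); rewrite -uv; ring.
  have u0 : chi u != 0 by rewrite (dchar_neq0 chiP).
  by apply: (mulfI u0); rewrite -!(dchar_mul chiP) um1 un1.
(* The inducing character takes at [n] the value of [chi] at a chosen unit modulo [q] congruent to
   [n] modulo [d]; the default 0 never occurs for [n] prime to [d]. *)
pose lift (n : int) := xget (0 : int)
  [set c : int | coprimez c q%:Z /\ (d%:Z %| c - n)%Z].
have liftP n : coprimez n d%:Z ->
    coprimez (lift n) q%:Z /\ (d%:Z %| lift n - n)%Z.
  move=> nd; rewrite /lift; case: xgetP => [y _ //|none].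
  by have [c hc] := coprimez_lift d0 q0 nd; case: (none c).
pose psi (n : int) := if coprimez n d%:Z then chi (lift n) else 0.
have psi_chi (n c : int) : coprimez c q%:Z -> (d%:Z %| c - n)%Z ->
    psi n = chi c.
  move=> cq dcn.
  have nd : coprimez n d%:Z.
    by rewrite -(coprimez_congr dcn); exact: coprimez_dvdr cq.
  rewrite /psi nd; have [lq dl] := liftP n nd; apply: chi_d => //.
  have -> : lift n - c = (lift n - n) - (c - n) by ring.
  by rewrite rpredB.
apply: (prim d psi ltdq); split => //; last first.
  by move=> n nq; rewrite (psi_chi n n) // subrr dvdz0.
split => [m n|n|n].
- have [md|md] := boolP (coprimez m d%:Z); last first.
    by rewrite /psi coprimezMl (negbTE md) mul0r.
  have [nd|nd] := boolP (coprimez n d%:Z); last first.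
    by rewrite /psi coprimezMl (negbTE nd) andbF mulr0.
  have [mq dm] := liftP m md; have [nq dn] := liftP n nd.
  rewrite (psi_chi m _ mq dm) (psi_chi n _ nq dn) -(dchar_mul chiP).
  apply: psi_chi; first by rewrite coprimezMl mq.
  have -> : lift m * lift n - m * n =
    (lift m - m) * lift n + m * (lift n - n) by ring.
  by apply: rpredD; [exact: dvdz_mulr | exact: dvdz_mull].
- have dnd : (d%:Z %| n + d%:Z - n)%Z by rewrite addrAC subrr add0r dvdzz.
  have [nd|nd] := boolP (coprimez n d%:Z); last first.
    by rewrite /psi (coprimez_congr dnd) (negbTE nd).
  have [nq dn] := liftP n nd; rewrite (psi_chi n _ nq dn); apply: psi_chi => //.
  have -> : lift n - (n + d%:Z) = (lift n - n) - d%:Z by ring.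
  by rewrite rpredB ?dvdzz.
- rewrite /psi; case: ifP => nd; last by rewrite eqxx.
  by have [nq _] := liftP n nd; rewrite (dchar_neq0 chiP).
Qed.

(** * Gauss sums *)

Lemma unit_sum_mul (V : nmodType) (k : nat) (f : int -> V) (u : int) :
  (0 < k)%N -> (forall m n, (k%:Z %| m - n)%Z -> f m = f n) ->
  coprimez u k%:Z ->
  \sum_(c < k | coprime c k) f (c%:Z * u) = \sum_(c < k | coprime c k) f c%:Z.
Proof.
move=> k0 fper uk.
have kn0 : k%:Z != 0 by rewrite eqz_nat -lt0n.
have modk (n : int) : (`|(n %% k%:Z)%Z|%N < k)%N.
  by rewrite -ltz_nat gez0_abs ?modz_ge0// ltz_pmod.
pose h (c : 'I_k) := Ordinal (modk (c%:Z * u)).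
have hE c : (k%:Z %| (h c)%:Z - c%:Z * u)%Z.
  by rewrite /h /= gez0_abs ?modz_ge0 // -eqz_mod_dvd modz_mod.
have h_inj : injective h.
  move=> c c' /(congr1 (fun i : 'I_k => i%:Z)) eq_h.
  have := hE c; have := hE c'; rewrite eq_h => h1 h2.
  have : (k%:Z %| (c%:Z - c'%:Z) * u)%Z.
    have -> : (c%:Z - c'%:Z) * u =
      ((h c')%:Z - c'%:Z * u) - ((h c')%:Z - c%:Z * u) by ring.
    by rewrite rpredB.
  rewrite coprimez_sym in uk; rewrite Gauss_dvdzl // -eqz_mod_dvd !modz_nat.
  by rewrite !modn_small // => /eqP[] /ord_inj.
rewrite [RHS](reindex_inj h_inj) /=; apply: eq_big => c.
  have := coprimez_congr (hE c); rewrite coprimezMl uk andbT.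
  by rewrite !coprimezE !absz_nat /= => ->.
by move=> _; apply: fper; rewrite -opprB rpredN; exact: hE.
Qed.

Lemma expi_congr (R : realType) (k : nat) (m n : int) : (0 < k)%N ->
  (k%:Z %| m - n)%Z -> expi (m%:~R / k%:R) = expi (n%:~R / k%:R) :> R[i].
Proof.
move=> k0 /dvdzP[t mn]; have -> : m = n + t * k%:Z by rewrite -mn addrC subrK.
rewrite rmorphD rmorphM /= mulrDl mulfK ?pnatr_eq0 -?lt0n // expiD expi_int.
by rewrite mulr1.
Qed.

Lemma expi_neq1 (R : realType) (x : R) : 0 < x < 1 -> expi x != 1.
Proof.
move=> /andP[x0 x1]; apply/eqP => e1; have := normc_expi_sub1 x.
rewrite e1 subrr normc0 expr0n /= => /esym/eqP; rewrite expf_eq0 mulrn_eq0 /=.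
rewrite gt_eqF // sin_gt0_pi // mulr_gt0 ?pi_gt0 //=.
by rewrite gtr_pMr ?pi_gt0.
Qed.

Lemma sum_expi_eq0 (R : realType) (k : nat) (m : int) : (0 < k)%N ->
  ~~ (k%:Z %| m)%Z -> \sum_(n < k) expi (m%:~R * n%:R / k%:R) = 0 :> R[i].
Proof.
move=> k0 km; have k0R : 0 < k%:R :> R by rewrite ltr0n.
have kz : k%:Z != 0 by rewrite eqz_nat -lt0n.
pose z : R[i] := expi (m%:~R / k%:R).
have z1 : z != 1.
  pose r := (m %% k%:Z)%Z.
  have -> : z = expi (r%:~R / k%:R).
    by apply: expi_congr => //; rewrite -eqz_mod_dvd modz_mod.
  have r0 : 0 < r.
    rewrite lt_neqAle modz_ge0 // andbT eq_sym.
    by apply: contra km => /eqP r0; apply/dvdz_mod0P.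
  have rk : r < k%:Z by rewrite ltz_pmod.
  apply: expi_neq1; rewrite divr_gt0 ?ltr0z //= ltr_pdivrMr // mul1r.
  by rewrite -[k%:R]/(k%:Z%:~R) ltr_int.
have zk : z ^+ k = 1 by rewrite -expiM divfK ?gt_eqF // expi_int.
under eq_bigr do rewrite mulrAC expiM -/z.
have := subrX1 z k; rewrite zk subrr => /esym/eqP.
by rewrite mulf_eq0 subr_eq0 (negbTE z1) /= => /eqP.
Qed.

(** The level [k] may be a proper multiple of the modulus of [chi]; the sum is then the Gauss sum of
    the conjugate of the character induced by [chi] modulo [k]. The conjugate is taken so that the
    value at [n] becomes proportional to [chi n]. *)
Definition gauss_sum (R : realType) (chi : int -> R[i]) (k : nat) (n : int) :=
  \sum_(c < k | coprime c k)
    (chi c%:Z)^* * expi ((c%:Z * n)%:~R / k%:R : R).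

Lemma conjCM (C : numClosedFieldType) (x y : C) : (x * y)^* = x^* * y^*.
Proof. exact: rmorphM. Qed.

Lemma card_units (k : nat) : #|[pred c : 'I_k | coprime c k]| = totient k.
Proof.
rewrite totient_count_coprime big_mkord -sum1_card big_mkcond /=.
by apply: eq_bigr => c _; rewrite inE coprime_sym; case: coprime.
Qed.

Lemma sum_units_const (R : realType) (k : nat) (x : R[i]) :
  \sum_(c < k | coprime c k) x = (totient k)%:R * x.
Proof. by rewrite -card_units sumr_const mulr_natl. Qed.

(** For [n] prime to [q], substitute [c n] for [c]. Otherwise let [g > 1] be the gcd and take a unit
    [u] congruent to 1 modulo [q / g] with [chi u != 1]: replacing [c] by [c u] leaves every
    exponential unchanged and multiplies the sum by [conj (chi u)], so the sum vanishes. *)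
Lemma gauss_sum_primitive (R : realType) (chi : int -> R[i]) (q : nat)
    (n : int) : (0 < q)%N -> primitive_character q chi ->
  gauss_sum chi q n = chi n * gauss_sum chi q 1.
Proof.
move=> q0 prim; have [chiP _] := prim.
have congr m m' : (q%:Z %| m - m')%Z -> chi m = chi m' by exact: dchar_congr.
have [nq|nq] := boolP (coprimez n q%:Z).
  have -> : gauss_sum chi q 1 = (chi n)^* * gauss_sum chi q n.
    rewrite /gauss_sum mulr_sumr.
    pose f (m : int) := (chi m)^* * expi (m%:~R / q%:R : R).
    under eq_bigr do rewrite mulr1 -/(f _).
    rewrite -(@unit_sum_mul _ _ f n) //; last first.
      by move=> m m' mm'; rewrite /f (congr _ _ mm') (expi_congr R q0 mm').
    apply: eq_bigr => c _; rewrite /f (dchar_mul chiP) rmorphM /=.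
    by rewrite mulrA (mulrC (chi n)^*).
  rewrite mulrA conj_eqV ?(normc_dchar q0 chiP) // divff ?mul1r //.
  by rewrite (dchar_neq0 chiP).
rewrite (dchar_eq0 chiP nq) mul0r.
pose g := gcdn `|n| q; pose d := (q %/ g)%N.
have gq : (g %| q)%N by exact: dvdn_gcdr.
have g0 : (0 < g)%N by exact: dvdn_gt0 gq.
have g1 : (1 < g)%N.
  by move: nq; rewrite coprimezE /coprime absz_nat -/g; case: (g) g0 => [|[]].
have dq : (d %| q)%N by apply/dvdnP; exists g; rewrite mulnC divnK.
have ltdq : (d < q)%N by rewrite ltn_Pdiv.
have [u [uq du u1]] := primitive_character_witness q0 prim dq ltdq.
pose f (m : int) := (chi m)^* * expi ((m * n)%:~R / q%:R : R).
have fper m m' : (q%:Z %| m - m')%Z -> f m = f m'.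
  move=> mm'; rewrite /f (congr _ _ mm') (@expi_congr R q (m * n) (m' * n)) //.
  by rewrite -mulrBl dvdz_mulr.
have := @unit_sum_mul _ _ f u q0 fper uq.
rewrite (_ : \sum_(c < q | _) f c%:Z = gauss_sum chi q n) //.
have -> : \sum_(c < q | coprime c q) f (c%:Z * u) =
    (chi u)^* * gauss_sum chi q n.
  rewrite mulr_sumr; apply: eq_bigr => c _.
  rewrite /f (dchar_mul chiP) rmorphM /= mulrA (mulrC (chi u)^*); congr (_ * _).
  apply: expi_congr => //.
  have -> : c%:Z * u * n - c%:Z * n = c%:Z * (n * (u - 1)) by ring.
  rewrite dvdz_mull // -(divnK gq) -/d PoszM mulrC dvdz_mul //.
  by rewrite dvdzE absz_nat dvdn_gcdl.
move=> /eqP; rewrite -subr_eq0 -{2}[gauss_sum _ _ _]mul1r -mulrBl mulf_eq0.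
case/orP => [|/eqP //]; rewrite subr_eq0 => /eqP e1.
by case/eqP: u1; rewrite -[LHS]conjCK e1 rmorph1.
Qed.

(* Parseval for the sequence [n |-> gauss_sum chi q n = chi n * tau]. *)
Lemma normc_gauss_sum (R : realType) (chi : int -> R[i]) (q : nat) :
  (0 < q)%N -> primitive_character q chi ->
  normc (gauss_sum chi q 1) ^+ 2 = q%:R.
Proof.
move=> q0 prim; have [chiP _] := prim.
have t0 : (0 < totient q)%N by rewrite totient_gt0.
have q0R : 0 < q%:R :> R by rewrite ltr0n.
have chi1 (c : 'I_q) : coprime c q -> chi c%:Z * (chi c%:Z)^* = 1.
  move=> cq; have cqz : coprimez c%:Z q%:Z by rewrite coprimezE.
  by rewrite conj_eqV ?(normc_dchar q0 chiP) // divff // (dchar_neq0 chiP).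
pose G n := gauss_sum chi q n.
have S1 : \sum_(n < q) G n%:Z * (G n%:Z)^* = (totient q)%:R * `|G 1| ^+ 2.
  rewrite -sum_units_const [RHS]big_mkcond /=; apply: eq_bigr => n _.
  rewrite /G gauss_sum_primitive // rmorphM /= mulrACA.
  case: ifP => nq; first by rewrite chi1 // mul1r normCK.
  by rewrite (dchar_eq0 chiP) ?mul0r // coprimezE nq.
have S2 : \sum_(n < q) G n%:Z * (G n%:Z)^* = (totient q)%:R * q%:R.
  under eq_bigr => n _ do rewrite /G /gauss_sum rmorph_sum /= big_distrlr /=.
  rewrite exchange_big /= -sum_units_const; apply: eq_bigr => c cq.
  rewrite exchange_big /= (bigD1 c) //= [X in _ + X]big1 ?addr0.
    rewrite (eq_bigr (fun=> 1)) ?sumr_const ?card_ord //= => n _.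
    rewrite conjCM conjCK mulrACA (mulrC (chi c%:Z)^*) chi1 // mul1r.
    by rewrite -normCK norm_normc normc_expi expr1n.
  move=> c' /andP[c'q c'c].
  have cc' : ~~ (q%:Z %| c%:Z - c'%:Z)%Z.
    rewrite -eqz_mod_dvd !modz_nat !modn_small // eqz_nat.
    by rewrite eq_sym; apply: contra c'c => /eqP/ord_inj ->.
  transitivity ((chi c%:Z)^* * chi c'%:Z *
      \sum_(n < q) expi ((c%:Z - c'%:Z)%:~R * n%:R / q%:R : R)).
    rewrite mulr_sumr; apply: eq_bigr => n _.
    rewrite conjCM conjCK mulrACA; congr (_ * _).
    rewrite -expiN -expiD; congr expi.
    rewrite !rmorphM rmorphB /= -!pmulrn; ring.
  by rewrite (sum_expi_eq0 R q0 cc') mulr0.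
have : `|G 1| ^+ 2 = q%:R.
  have tn0 : (totient q)%:R != 0 :> R[i] by rewrite pnatr_eq0 -lt0n.
  by apply: (mulfI tn0); rewrite -S1 S2.
rewrite norm_normc -rmorphXn /= => /(congr1 (@complex.Re R)) /= ->.
by rewrite -(rmorph_nat (real_complex R)).
Qed.

Lemma sum_ord_blocks (V : nmodType) (F : nat -> V) (p k : nat) :
  \sum_(c < p * k) F c = \sum_(j < p) \sum_(c < k) F (j * k + c)%N.
Proof.
elim: p => [|p IH]; first by rewrite !big_ord0.
rewrite big_ord_recr /= -IH -!(big_mkord xpredT F) mulSnr.
rewrite (@big_cat_nat _ _ _ (p * k)) ?leq_addr //=; congr (_ + _).
rewrite -{1}[(p * k)%N]add0n big_addn addKn big_mkord.
by apply: eq_bigr => c _; rewrite addnC.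
Qed.

(** Dropping the condition that [p] does not divide [c] makes the sum vanish, since each class
    modulo [k] then runs over all [p]-th roots of unity and [p] does not divide [n]. Hence the sum
    is minus the contribution of the multiples [c = p j], which is a Gauss sum at level [k]. *)
Lemma gauss_sum_mul_prime (R : realType) (chi : int -> R[i]) (q k p : nat)
    (n : int) :
  (0 < k)%N -> dirichlet_character q chi -> (q %| k)%N -> prime p ->
  coprime p k -> ~~ (p%:Z %| n)%Z ->
  gauss_sum chi (k * p) n = - (chi p%:Z)^* * gauss_sum chi k n.
Proof.
move=> k0 chiP qk pp pk pn; have p0 := prime_gt0 pp.
have q0 : (0 < q)%N := dvdn_gt0 k0 qk.
have p0R : p%:R != 0 :> R by rewrite pnatr_eq0 -lt0n.
have k0R : k%:R != 0 :> R by rewrite pnatr_eq0 -lt0n.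
pose F (c : nat) := (chi c%:Z)^* * expi ((c%:Z * n)%:~R / (k * p)%:R : R).
have total : \sum_(c < k * p) (if coprime c k then F c else 0) = 0.
  rewrite mulnC (sum_ord_blocks (fun c => if coprime c k then F c else 0)).
  rewrite exchange_big big1 //= => c _.
  transitivity (\sum_(j < p) (if coprime c k then (chi c%:Z)^* *
      expi ((c%:Z * n)%:~R / (k * p)%:R : R) else 0) *
      expi (n%:~R * j%:R / p%:R : R)).
    apply: eq_bigr => j _.
    have -> : coprime (j * k + c) k = coprime c k.
      by rewrite !(coprime_sym _ k) /coprime gcdnMDl.
    case: ifP => _; last by rewrite mul0r.
    rewrite /F (@dchar_congr _ _ _ chiP (j * k + c)%N%:Z c%:Z); last first.
      by rewrite PoszD addrK PoszM dvdz_mull // dvdzE !absz_nat.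
    rewrite -mulrA -expiD; congr (_ * expi _).
    by rewrite PoszD PoszM mulrDl rmorphD !rmorphM /= -!pmulrn ?natrM;
      field; rewrite p0R.
  by rewrite -mulr_sumr (sum_expi_eq0 R p0 pn) mulr0.
have multiples : \sum_(c < k * p)
      (if coprime c k && (p %| c)%N then F c else 0) =
    (chi p%:Z)^* * gauss_sum chi k n.
  rewrite (sum_ord_blocks (fun c =>
    if coprime c k && (p %| c)%N then F c else 0)).
  rewrite /gauss_sum mulr_sumr [RHS]big_mkcond /=; apply: eq_bigr => j _.
  rewrite (bigD1 (Ordinal p0)) //= addn0 dvdn_mull // andbT big1 ?addr0.
    rewrite coprimeMl pk andbT; case: ifP => // jk.
    rewrite /F PoszM (dchar_mul chiP) conjCM (mulrC (chi j%:Z)^*).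
    rewrite [RHS]mulrA; congr (_ * expi _).
    by rewrite !rmorphM ?natrM /= -!pmulrn; field; rewrite ?p0R ?k0R.
  move=> i i0; rewrite dvdn_addr ?dvdn_mull // gtnNdvd ?andbF //.
  by rewrite lt0n; apply: contra i0 => /eqP i0; apply/eqP/val_inj.
rewrite mulNr -multiples; apply/eqP; rewrite -addr_eq0; apply/eqP.
rewrite -[RHS]total.
rewrite /gauss_sum big_mkcond -big_split /=; apply: eq_bigr => c _.
rewrite coprimeMr (coprime_sym c p) (prime_coprime _ pp).
by case: (coprime c k); case: (p %| c)%N; rewrite /= ?addr0 ?add0r.
Qed.

(** Every prime of [r] contributes a factor [- conj (chi p)] of modulus 1. What matters is that [u]
    is the same for all [n], so that it leaves a sum over [n] as a common factor. *)
Lemma gauss_sum_mul_sqfree (R : realType) (chi : int -> R[i]) (q r : nat) :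
  (0 < q)%N -> dirichlet_character q chi -> (0 < r)%N ->
  (forall p, prime p -> ~~ (p * p %| r)%N) -> coprime q r ->
  exists2 u : R[i], normc u = 1 & forall n : int, coprimez n r%:Z ->
    gauss_sum chi (q * r) n = u * gauss_sum chi q n.
Proof.
move=> q0 chiP; elim/ltn_ind: r => r IH r0 sqf qr.
have [r1|r1] := leqP r 1.
  exists 1 => [|n _]; first exact: normc1.
  by have -> : r = 1%N; [lia|rewrite muln1 mul1r].
have pp := pdiv_prime r1; set p := pdiv r in pp.
have [r' rE] : exists r', r = (r' * p)%N by apply/dvdnP/pdiv_dvd.
have p1 := prime_gt1 pp.
have r'0 : (0 < r')%N by move: r0; rewrite rE muln_gt0 => /andP[].
have pr' : coprime p r'.
  rewrite prime_coprime //; apply: contra (sqf p pp) => pr'.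
  by rewrite rE dvdn_mul.
have qp : coprime q p by move: qr; rewrite rE coprimeMr => /andP[].
have qr' : coprime q r' by move: qr; rewrite rE coprimeMr => /andP[].
have [||p2 pp2||u u1 uE] := IH r' => //.
- by rewrite rE ltn_Pmulr.
- by apply: contra (sqf p2 pp2) => h; rewrite rE dvdn_mulr.
exists (- (chi p%:Z)^* * u) => [|n nr].
  rewrite normcM normcN normc_conj (normc_dchar q0 chiP) ?mul1r //.
  by rewrite coprimezE coprime_sym.
rewrite rE mulnA (@gauss_sum_mul_prime _ _ q) ?muln_gt0 ?q0 ?dvdn_mulr //.
- rewrite uE ?mulrA //; move: nr; rewrite rE PoszM coprimezMr.
  by case/andP.
- by rewrite coprimeMr coprime_sym qp.
- move: nr; rewrite rE PoszM coprimezMr => /andP[_].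
  by rewrite coprimezE absz_nat coprime_sym prime_coprime // dvdzE absz_nat.
Qed.

(** * Orthogonality of primitive characters at a common level *)

(** Replacing [c] by [c u] multiplies the sum by [chi u * conj (psi u)], which is not 1. *)
Lemma dchar_sum_eq0 (R : realType) (chi psi : int -> R[i]) (q q' k : nat)
    (u : int) :
  (0 < k)%N -> dirichlet_character q chi -> dirichlet_character q' psi ->
  (q %| k)%N -> (q' %| k)%N -> coprimez u k%:Z -> chi u != psi u ->
  \sum_(c < k | coprime c k) chi c%:Z * (psi c%:Z)^* = 0.
Proof.
move=> k0 chiP psiP qk q'k uk neq_u.
pose f (m : int) := chi m * (psi m)^*.
have fper m n : (k%:Z %| m - n)%Z -> f m = f n.
  move=> kmn; rewrite /f (@dchar_congr _ q _ chiP m n); last first.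
    by apply: dvdz_trans kmn; rewrite dvdzE !absz_nat.
  by rewrite (@dchar_congr _ q' _ psiP m n) //; apply: dvdz_trans kmn.
have := unit_sum_mul k0 fper uk.
set S := (X in _ = X) => SE; rewrite -/S.
have SuS : f u * S = S.
  rewrite -{2}SE mulr_sumr; apply: eq_bigr => c _.
  by rewrite /f (dchar_mul chiP) (dchar_mul psiP) conjCM mulrC mulrACA.
have psiu : normc (psi u) = 1.
  apply: (normc_dchar _ psiP); first exact: dvdn_gt0 q'k.
  exact: coprimez_dvdr uk.
have fu : f u != 1.
  apply: contra neq_u => /eqP; rewrite /f conj_eqV // => fu.
  have pn0 : psi u != 0.
    apply/eqP => p0; move: psiu; rewrite p0 normc0 => /esym/eqP.
    by rewrite oner_eq0.
  by rewrite -[chi u](mulfVK pn0) fu mul1r.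
have /eqP : (f u - 1) * S = 0 by rewrite mulrBl mul1r SuS subrr.
by rewrite mulf_eq0 subr_eq0 (negbTE fu) => /eqP.
Qed.

Lemma coprimez_chinese (q r : nat) (n : int) : coprime q r ->
  coprimez n q%:Z -> exists u : int,
  [/\ coprimez u (q * r)%N%:Z, (q%:Z %| u - n)%Z & (r%:Z %| u - 1)%Z].
Proof.
move=> qr nq; have qrz : coprimez q%:Z r%:Z by rewrite coprimezE.
exists (zchinese q r n 1).
have h1 : (q%:Z %| zchinese q r n 1 - n)%Z.
  by rewrite -eqz_mod_dvd zchinese_modl.
have h2 : (r%:Z %| zchinese q r n 1 - 1)%Z.
  by rewrite -eqz_mod_dvd zchinese_modr.
split=> //; rewrite PoszM coprimezMr (coprimez_congr h1) nq.
by rewrite (coprimez_congr h2) coprimezE coprime1n.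
Qed.

(** The gcd [g] of [q] and [q'] is a proper divisor of [q], so primitivity gives [c] congruent to 1
    modulo [g] with [chi c != 1]. The Chinese remainder theorem yields [u] congruent to [c] modulo
    [q] and to 1 modulo [r]; as [q'] divides [g r], this forces [psi u = 1]. *)
Lemma primitive_character_neq_unit (R : realType) (chi psi : int -> R[i])
    (q q' r : nat) :
  (0 < q)%N -> (0 < r)%N -> primitive_character q chi ->
  dirichlet_character q' psi -> coprime q r -> (q' %| q * r)%N ->
  ~~ (q %| q')%N ->
  exists2 u : int, coprimez u (q * r)%N%:Z & chi u != psi u.
Proof.
move=> q0 r0 prim psiP qr q'k qq'; have [chiP _] := prim.
pose g := gcdn q q'.
have q'0 : (0 < q')%N by apply: dvdn_gt0 q'k; rewrite muln_gt0 q0.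
have gq : (g %| q)%N by exact: dvdn_gcdl.
have g0 : (0 < g)%N by exact: dvdn_gt0 gq.
have ltgq : (g < q)%N.
  rewrite ltn_neqAle dvdn_leq // andbT; apply: contra qq' => /eqP <-.
  exact: dvdn_gcdr.
have [c [cq gc c1]] := primitive_character_witness q0 prim gq ltgq.
have [u [uk uc u1]] := coprimez_chinese qr cq.
exists u => //; rewrite (dchar_congr chiP uc).
rewrite (@dchar_congr _ _ _ psiP u 1) ?(dchar1 psiP) //.
have q'gr : (q' %| g * r)%N.
  by rewrite /g muln_gcdl dvdn_gcd q'k dvdn_mulr.
apply: (@dvdz_trans (g * r)%N%:Z); first by rewrite dvdzE !absz_nat.
rewrite PoszM Gauss_dvdz ?u1 ?andbT.
  rewrite -(subrK c u) -addrA rpredD //.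
  by apply: dvdz_trans uc; rewrite dvdzE !absz_nat.
by rewrite coprimezE !absz_nat; apply: coprime_dvdl qr.
Qed.

(** A unit of the common level separating the two characters suffices. If the moduli differ, one of
    them fails to divide the other and the preceding lemma applies; if they agree, a residue where
    the characters differ is moved to a unit of the level. *)
Lemma primitive_character_orthogonal (R : realType) (chi psi : int -> R[i])
    (q q' r r' : nat) :
  (0 < q * r)%N -> primitive_character q chi -> primitive_character q' psi ->
  coprime q r -> coprime q' r' -> (q * r = q' * r')%N ->
  (q, chi) <> (q', psi) ->
  \sum_(c < q * r | coprime c (q * r)) chi c%:Z * (psi c%:Z)^* = 0.
Proof.
move=> k0 chiprim psiprim qr q'r' eqk neq.
have [chiP _] := chiprim; have [psiP _] := psiprim.
have [q0 r0] : (0 < q)%N /\ (0 < r)%N by apply/andP; rewrite -muln_gt0.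
have [q'0 r'0] : (0 < q')%N /\ (0 < r')%N.
  by apply/andP; rewrite -muln_gt0 -eqk.
suff [u uk u_neq] : exists2 u : int, coprimez u (q * r)%N%:Z & chi u != psi u.
  apply: (@dchar_sum_eq0 _ _ _ q q' _ u) => //; first exact: dvdn_mulr.
  by rewrite eqk dvdn_mulr.
have [qq'|] := boolP (q %| q')%N; last first.
  by apply: primitive_character_neq_unit => //; rewrite eqk dvdn_mulr.
have [q'q|] := boolP (q' %| q)%N; last first.
  move=> nq'q.
  have [|u uk u_neq] :=
    primitive_character_neq_unit q'0 r'0 psiprim chiP q'r' _ nq'q.
    by rewrite -eqk dvdn_mulr.
  by exists u; rewrite ?eqk // eq_sym.
have qE : q = q' by apply/eqP; rewrite eqn_dvd qq'.
have [n n_neq] : exists n, chi n != psi n.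
  apply: contrapT => none; apply: neq; congr (_, _) => //.
  apply/funext => n; apply/eqP/negPn/negP => h; apply: none.
  by exists n.
have nq : coprimez n q%:Z.
  apply: contraNT n_neq => nq; rewrite (dchar_eq0 chiP nq) (dchar_eq0 psiP) //.
  by rewrite -qE.
have [u [uk un _]] := coprimez_chinese qr nq.
exists u => //; rewrite (dchar_congr chiP un) (@dchar_congr _ _ _ psiP u n) //.
by rewrite -qE.
Qed.

(** * Comparison of the harmonic sum with sums of [1 / phi(r)] *)

Lemma sum_multiples (V : nmodType) (p X : nat) (P : pred nat)
    (F : nat -> V) : (0 < p)%N ->
  \sum_(1 <= r < X.+1 | (p %| r)%N && P r) F r =
  \sum_(1 <= r < (X %/ p).+1 | P (p * r)%N) F (p * r)%N.
Proof.
move=> p0; elim: X => [|X IH]; first by rewrite div0n !big_geq.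
rewrite big_mkcond big_nat_recr //= -big_mkcond IH divnS //.
have [pX|pX] := boolP (p %| X.+1)%N; last by rewrite /= addr0 add0n.
rewrite /= add1n [RHS]big_mkcond big_nat_recr //= -big_mkcond /=.
have -> : (p * (X %/ p).+1)%N = X.+1; last by [].
by have := divnS X p0; rewrite pX add1n => <-; rewrite mulnC divnK.
Qed.

Lemma coprime_primes_prod (p : nat) (s : seq nat) : prime p -> all prime s ->
  p \notin s -> coprime p (\prod_(x <- s) x).
Proof.
move=> pp; elim: s => [|x s IH] /=; first by rewrite big_nil coprimen1.
move=> /andP[px sp]; rewrite inE negb_or => /andP[pnx pns].
rewrite big_cons coprimeMr IH // andbT prime_coprime // dvdn_prime2 //.
Qed.

Section SmoothSums.
Variables (R : realType) (q : nat).
Hypothesis q_gt0 : (0 < q)%N.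

Definition smooth_sum (s : seq nat) (X : nat) : R :=
  \sum_(1 <= n < X.+1 | all (mem s) (primes n)) n%:R^-1.

(** For a list of distinct primes, dividing their product encodes both squarefreeness and having all
    prime factors in [s]. *)
Definition totient_sum (s : seq nat) (X : nat) : R :=
  \sum_(1 <= r < X.+1 | (r %| \prod_(p <- s) p)%N && coprime r q)
    (totient r)%:R^-1.

(** The part of the Euler product of [q / phi(q)] that comes from the primes in [s]. *)
Definition euler_ratio (s : seq nat) : R :=
  \prod_(p <- s | (p %| q)%N) (p%:R / (p.-1)%:R).

Lemma totient_sum_ge0 s X : 0 <= totient_sum s X.
Proof. by apply: sumr_ge0 => r _; rewrite invr_ge0. Qed.

Lemma le_totient_sum s X Y : (X <= Y)%N -> totient_sum s X <= totient_sum s Y.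
Proof.
move=> XY; rewrite /totient_sum (@big_cat_nat _ _ _ X.+1 1 Y.+1) //= lerDl.
by apply: sumr_ge0 => r _; rewrite invr_ge0.
Qed.

Lemma euler_ratio_ge0 s : 0 <= euler_ratio s.
Proof. by apply: prodr_ge0 => p _; rewrite divr_ge0. Qed.

(** Higher powers of [p] are allowed, so the recursion keeps [p :: s] and only lowers the bound; in
    the squarefree sum [p] is used up. *)
Lemma smooth_sum_cons p s X : prime p -> p \notin s ->
  smooth_sum (p :: s) X =
    smooth_sum s X + p%:R^-1 * smooth_sum (p :: s) (X %/ p).
Proof.
move=> pp ps; have p0 := prime_gt0 pp.
rewrite /smooth_sum (bigID (fun n => (p %| n)%N)) /= addrC; congr (_ + _).
  rewrite big_nat_cond [RHS]big_nat_cond; apply: eq_bigl => n.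
  have [/andP[n1 _]|] //= := boolP (1 <= n < X.+1)%N.
  apply/andP/allP => [[/allP sn pn] x xn|sn].
    have := sn x xn; rewrite !inE => /orP[/eqP xp|//].
    by move: xn pn; rewrite xp mem_primes => /and3P[_ _ ->].
  split; first by apply/allP => x /sn; rewrite !inE => ->; rewrite orbT.
  apply/negP => pn; have := sn p; rewrite mem_primes pp n1 pn => /(_ isT).
  by rewrite /= (negbTE ps).
rewrite mulr_sumr.
under eq_bigl do rewrite andbC.
rewrite (sum_multiples X (fun n => all (mem (p :: s)) (primes n))) //.
rewrite big_nat_cond [RHS]big_nat_cond; apply: eq_big => [n|n _].
  have [/andP[n1 _]|] //= := boolP (1 <= n < (X %/ p).+1)%N.
  apply/allP/allP => sn x xn.
    by apply: sn; rewrite primesM // xn orbT.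
  move: xn; rewrite primesM // primes_prime // inE => /orP[|/sn //].
  by rewrite inE => /eqP ->; rewrite inE eqxx.
by rewrite natrM invfM.
Qed.

Lemma totient_sum_cons p s X : prime p -> all prime s -> p \notin s ->
  totient_sum (p :: s) X = totient_sum s X +
    (if coprime p q then (p.-1)%:R^-1 * totient_sum s (X %/ p) else 0).
Proof.
move=> pp sp ps; have p0 := prime_gt0 pp.
have cop := coprime_primes_prod pp sp ps.
rewrite /totient_sum (bigID (fun n => (p %| n)%N)) /= addrC; congr (_ + _).
  apply: eq_bigl => r; rewrite big_cons.
  have [pr|pr] := boolP (p %| r)%N; rewrite ?andbF ?andbT /=.
    apply/esym/negP => /andP[rs _]; move: cop.
    by rewrite prime_coprime // (dvdn_trans pr rs).
  by rewrite Gauss_dvdr // coprime_sym prime_coprime.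
under eq_bigl do rewrite andbC.
rewrite (sum_multiples X (fun r =>
  (r %| \prod_(x <- p :: s) x)%N && coprime r q)) //.
have [pq|pq] := boolP (coprime p q); last first.
  by rewrite big1 // => r; rewrite coprimeMl (negbTE pq) andbF.
rewrite mulr_sumr big_cons; apply: eq_big => [r|r].
  by rewrite dvdn_pmul2l // coprimeMl pq.
rewrite dvdn_pmul2l // => /andP[rs _].
rewrite totient_coprime ?natrM ?invfM ?(totient_prime pp) //.
exact: coprime_dvdr rs cop.
Qed.

Lemma euler_ratio_cons p s :
  euler_ratio (p :: s) =
    (if (p %| q)%N then p%:R / p.-1%:R else 1) * euler_ratio s.
Proof. by rewrite /euler_ratio big_cons; case: ifP; rewrite ?mul1r. Qed.

(** Formally [1 / phi(r)] is the sum of [1/n] over all [n] with squarefree kernel [r], and a kernel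
    never exceeds its integer, so both sums may be cut at the same [X]. The primes dividing [q],
    absent from [r], are supplied by [euler_ratio]. Induction on [s], and inside it on [X], avoids
    the infinite expansion. *)
Lemma smooth_sum_le s X : uniq s -> all prime s ->
  smooth_sum s X <= euler_ratio s * totient_sum s X.
Proof.
elim: s X => [|p s IH] X.
  move=> _ _; rewrite /euler_ratio /totient_sum /smooth_sum !big_nil mul1r.
  rewrite big_nat_cond [leRHS]big_nat_cond.
  rewrite (eq_bigl (fun n : nat => (n == 1%N) && (0 < X)%N)).
    rewrite [leRHS](eq_bigl (fun n : nat => (n == 1%N) && (0 < X)%N)).
      by apply: ler_sum => n /andP[/eqP -> _].
    move=> n; rewrite dvdn1.
    case: eqVneq => [->|]; rewrite ?coprime1n ?andbF //.
    by rewrite !andbT.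
  move=> n; have [->|n1] := eqVneq n 1%N; first by rewrite /= andbT.
  apply/negP => /andP[/andP[n0 _]].
  have n2 : (1 < n)%N by rewrite ltn_neqAle eq_sym n1.
  have : pdiv n \in primes n by rewrite mem_primes pdiv_prime // pdiv_dvd n0.
  by case: (primes n).
move=> /= /andP[ps us] /andP[pp sp].
have p0R : 0 < p%:R :> R by rewrite ltr0n prime_gt0.
have p10R : 0 < p.-1%:R :> R by rewrite ltr0n; have := prime_gt1 pp; lia.
have pE : p%:R = p.-1%:R + 1 :> R by rewrite natr1 prednK // prime_gt0.
elim/ltn_ind: X => X IHX.
have [->|X0] := posnP X.
  by rewrite /smooth_sum /totient_sum !big_geq // mulr0.
rewrite smooth_sum_cons //.
have XpX : (X %/ p < X)%N by rewrite ltn_Pdiv // prime_gt1.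
apply: (@le_trans _ _ (euler_ratio s * totient_sum s X +
  p%:R^-1 * (euler_ratio (p :: s) * totient_sum (p :: s) (X %/ p)))).
  by rewrite lerD ?IH // ler_pM2l ?invr_gt0 // IHX.
rewrite !totient_sum_cons // euler_ratio_cons.
have E0 := euler_ratio_ge0 s; set E := euler_ratio s in E0 *.
have W1 : totient_sum s (X %/ p) <= totient_sum s X.
  by apply: le_totient_sum; apply: leq_div.
have W2 : totient_sum s (X %/ p %/ p) <= totient_sum s (X %/ p).
  by apply: le_totient_sum; apply: leq_div.
have W20 := totient_sum_ge0 s (X %/ p %/ p).
move: (totient_sum s X) (totient_sum s (X %/ p)) (totient_sum s (X %/ p %/ p))
  W1 W2 W20 => a b c ba cb c0.
have pq : coprime p q = ~~ (p %| q)%N by rewrite prime_coprime.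
rewrite pq; case: ifP => /= pdq; last first.
  rewrite !mul1r [leRHS]mulrDr lerD2l mulrCA ler_wpM2l // ler_pdivrMl //.
  have -> : p%:R * (p.-1%:R^-1 * b) = b + p.-1%:R^-1 * b.
    by rewrite pE; field; rewrite gt_eqF.
  by rewrite lerD2l ler_pM2l ?invr_gt0.
rewrite !addr0.
have -> : p%:R^-1 * (p%:R / p.-1%:R * E * b) = p.-1%:R^-1 * (E * b).
  by field; rewrite !gt_eqF.
have -> : p%:R / p.-1%:R * E * a = E * a + p.-1%:R^-1 * (E * a).
  by rewrite pE; field; rewrite gt_eqF.
by rewrite lerD2l ler_pM2l ?invr_gt0 // ler_wpM2l.
Qed.

Lemma euler_ratio_le s : uniq s -> all prime s ->
  euler_ratio s <= q%:R / (totient q)%:R.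
Proof.
move=> us /allP sp.
have t0 : 0 < (totient q)%:R :> R by rewrite ltr0n totient_gt0.
have f1 p : prime p -> 1 <= p%:R / p.-1%:R :> R.
  move=> pp; rewrite ler_pdivlMr ?ltr0n; last by have := prime_gt1 pp; lia.
  by rewrite mul1r ler_nat leq_pred.
have -> : q%:R / (totient q)%:R = \prod_(p <- primes q) (p%:R / p.-1%:R) :> R.
  rewrite totientE // {1}(prod_prime_decomp q_gt0) prime_decompE big_map /=.
  rewrite !natr_prod -prodf_div big_seq [RHS]big_seq; apply: eq_bigr => p.
  rewrite mem_primes => /and3P[pp _ pq].
  have l0 : (0 < logn p q)%N by rewrite logn_gt0 mem_primes pp q_gt0.
  have p1 := prime_gt1 pp.
  rewrite -{1}(prednK l0) expnS !natrM -mulf_div divff ?mulr1 //.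
  by rewrite pnatr_eq0 expn_eq0; lia.
rewrite /euler_ratio (bigID (fun p => p \in s) predT) /=.
have -> : \prod_(p <- s | (p %| q)%N) (p%:R / p.-1%:R) =
   \prod_(p <- primes q | p \in s) (p%:R / p.-1%:R) :> R.
  rewrite -big_filter -[RHS]big_filter; apply: perm_big; apply: uniq_perm.
  - exact: filter_uniq.
  - by rewrite filter_uniq // primes_uniq.
  move=> p; rewrite !mem_filter mem_primes q_gt0 /=.
  have [ps|ps] := boolP (p \in s); rewrite ?andbF ?andbT //=.
  by rewrite sp // andbT.
rewrite -[leLHS]mulr1 ler_wpM2l //.
  by apply: prodr_ge0 => p _; rewrite divr_ge0.
rewrite big_seq_cond; elim/big_ind: _ => // [x y x1 y1|p].
  by rewrite -[1]mulr1 ler_pM.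
by rewrite mem_primes => /andP[/andP[pp _] _]; exact: f1.
Qed.

End SmoothSums.

Definition primes_upto (z : nat) := [seq p <- iota 1 z | prime p].

Lemma mem_primes_upto z p : (p \in primes_upto z) = prime p && (p <= z)%N.
Proof.
rewrite mem_filter mem_iota; case: (boolP (prime p)) => //= pp.
by rewrite prime_gt0 //= add1n ltnS.
Qed.

Lemma primes_upto_uniq z : uniq (primes_upto z).
Proof. by rewrite filter_uniq ?iota_uniq. Qed.

Lemma primes_upto_prime z : all prime (primes_upto z).
Proof. exact: filter_all. Qed.

Lemma ln_le_harmonic (R : realType) (z : nat) :
  ln z.+1%:R <= \sum_(1 <= n < z.+1) n%:R^-1 :> R.
Proof.
elim: z => [|z IH]; first by rewrite big_geq // ln1.
rewrite big_nat_recr //=.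
have z0 : 0 < z.+1%:R :> R by [].
have -> : z.+2%:R = z.+1%:R * (1 + z.+1%:R^-1) :> R.
  by rewrite mulrDr mulr1 divff ?gt_eqF // natr1.
have i0 : 0 < z.+1%:R^-1 :> R by rewrite invr_gt0.
rewrite lnM ?posrE ?addr_gt0 //= lerD // le_ln1Dx //.
by rewrite (lt_trans _ i0) // oppr_lt0.
Qed.

(** Every [n <= z] has only prime factors up to [z], so the harmonic sum is part of the smooth
    sum. *)
Lemma harmonic_le_totient_sum (R : realType) (q z X : nat) : (0 < q)%N ->
  (z <= X)%N ->
  \sum_(1 <= n < z.+1) n%:R^-1
    <= q%:R / (totient q)%:R * totient_sum R q (primes_upto z) X.
Proof.
move=> q0 zX.
apply: (@le_trans _ _ (smooth_sum R (primes_upto z) X)).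
  rewrite /smooth_sum [leRHS]big_mkcond /= (@big_cat_nat _ _ _ z.+1 1 X.+1) //=.
  rewrite -[leLHS]addr0 lerD //; last first.
    by apply: sumr_ge0 => n _; case: ifP => // _; rewrite invr_ge0.
  rewrite big_nat [leRHS]big_nat; apply: ler_sum => n /andP[n0 nz].
  case: ifP => // /negbT/negP[]; apply/allP => p.
  rewrite /= mem_primes_upto mem_primes => /and3P[-> _ pn] /=.
  by rewrite -ltnS; apply: leq_ltn_trans nz; exact: dvdn_leq.
apply: (@le_trans _ _ (euler_ratio R q (primes_upto z) *
                       totient_sum R q (primes_upto z) X)).
  by apply: smooth_sum_le; rewrite ?primes_upto_uniq ?primes_upto_prime.
rewrite ler_wpM2r ?totient_sum_ge0 //.
exact: (euler_ratio_le R q0 (primes_upto_uniq z) (primes_upto_prime z)).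
Qed.

(** * Sums of [ln p / p] over primes, and products of primes *)

Lemma ln_nat_ge0 (R : realType) (n : nat) : 0 <= ln n%:R :> R.
Proof.
case: n => [|n]; first by rewrite ln0.
by rewrite ln_ge0 // ler1n.
Qed.

Lemma ln_natE (R : realType) (m : nat) : (0 < m)%N ->
  ln m%:R = \sum_(p <- primes m) (logn p m)%:R * ln p%:R :> R.
Proof.
move=> m0; rewrite {1}(prod_prime_decomp m0) prime_decompE big_map /=.
rewrite (_ : \sum_(p <- _) _ =
  \sum_(p <- primes m | prime p) (logn p m)%:R * ln p%:R); last first.
  rewrite big_seq [RHS]big_seq_cond; apply: eq_bigl => p.
  by rewrite mem_primes; case: (prime p); rewrite ?andbT.
rewrite (_ : (\prod_(p <- _) _)%N =
  (\prod_(p <- primes m | prime p) p ^ logn p m)%N); last first.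
  rewrite big_seq [RHS]big_seq_cond; apply: eq_bigl => p.
  by rewrite mem_primes; case: (prime p); rewrite ?andbT.
elim: (primes m) => [|p s IH]; first by rewrite !big_nil ln1.
rewrite !big_cons; case: ifP => // pp; have p0 := prime_gt0 pp.
rewrite natrM lnM ?posrE ?ltr0n ?expn_gt0 ?p0 //; last first.
  by apply: prodn_cond_gt0 => x px; rewrite expn_gt0 prime_gt0.
by rewrite IH natrX lnXn ?ltr0n // mulr_natl.
Qed.

(* [n / p <= 2 (n %/ p)] for [p <= n], and [n %/ p] is at most the exponent of
   [p] in [n`!]; since [n`! <= n ^ n] no Chebyshev bound is needed. *)
Lemma sum_ln_prime_le (R : realType) (n : nat) : (0 < n)%N ->
  \sum_(p <- primes_upto n) p%:R^-1 * ln p%:R <= 2 * ln n%:R :> R.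
Proof.
move=> n0; have n0R : 0 < n%:R :> R by rewrite ltr0n.
have f0 : (0 < n`!)%N by exact: fact_gt0.
have fle : ln n`!%:R <= n%:R * ln n%:R :> R.
  rewrite mulr_natl -lnXn // ler_ln ?posrE ?exprn_gt0 ?ltr0n // -natrX ler_nat.
  rewrite fact_prod; apply: (@leq_trans (\prod_(1 <= i < n.+1) n)).
    rewrite !big_nat; apply: leq_prod => i; rewrite ltnS => /andP[] //.
  by rewrite prod_nat_const_nat subSS subn0.
rewrite -(ler_pM2l n0R) mulrCA.
apply: le_trans (_ : 2 * ln n`!%:R <= _); last by rewrite ler_pM2l.
rewrite ln_natE //.
apply: (@le_trans _ _
  (2 * \sum_(p <- primes_upto n) (logn p n`!)%:R * ln p%:R)).
  rewrite !mulr_sumr big_seq [leRHS]big_seq; apply: ler_sum => p.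
  rewrite mem_primes_upto => /andP[pp pn]; have p0 := prime_gt0 pp.
  have p0R : 0 < p%:R :> R by rewrite ltr0n.
  rewrite !mulrA ler_wpM2r ?ln_nat_ge0 // ler_pdivrMr // -!natrM ler_nat.
  have h1 : (n %/ p <= logn p n`!)%N.
    by rewrite logn_fact // big_nat_recl //= expn1 leq_addr.
  have h2 : (0 < n %/ p)%N by rewrite divn_gt0.
  have h3 := ltn_ceil n p0.
  apply: (@leq_trans ((2 * (n %/ p)) * p)); first by nia.
  by rewrite leq_mul2r leq_mul2l h1 !orbT.
rewrite ler_pM2l //; apply: ler_sum_uniq_subset.
- exact: primes_upto_uniq.
- exact: primes_uniq.
- move=> p; rewrite mem_primes_upto mem_primes => /andP[pp pn].
  by rewrite pp f0 dvdn_fact // prime_gt0.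
- by move=> p; rewrite mulr_ge0 ?ln_nat_ge0.
Qed.

Lemma sum_ln_prime_sqr_le (R : realType) (n : nat) : (0 < n)%N ->
  \sum_(p <- primes_upto n) p%:R^-1 * ln p%:R ^+ 2 <= 2 * ln n%:R ^+ 2 :> R.
Proof.
move=> n0.
apply: (@le_trans _ _ (\sum_(p <- primes_upto n) p%:R^-1 * ln p%:R * ln n%:R)).
  rewrite big_seq [leRHS]big_seq; apply: ler_sum => p.
  rewrite mem_primes_upto => /andP[pp pn]; have p0 := prime_gt0 pp.
  rewrite -mulrA ler_wpM2l ?invr_ge0 // expr2 ler_wpM2l ?ln_nat_ge0 //.
  by rewrite ler_ln ?posrE ?ltr0n // ler_nat.
rewrite -mulr_suml [ln n%:R ^+ 2]expr2 mulrA ler_wpM2r ?ln_nat_ge0 //.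
exact: sum_ln_prime_le.
Qed.

Lemma sqfree_primes_prod (s : seq nat) (p : nat) : uniq s -> all prime s ->
  prime p -> ~~ (p * p %| \prod_(x <- s) x)%N.
Proof.
move=> us sp pp; have p1 := prime_gt1 pp; elim: s us sp => [|x s IH] /=.
  by rewrite big_nil dvdn1; nia.
move=> /andP[xs us] /andP[px sp]; rewrite big_cons.
have [pE|px'] := eqVneq p x.
  rewrite -pE dvdn_pmul2l ?prime_gt0 // -prime_coprime //.
  by rewrite coprime_primes_prod // pE.
rewrite Gauss_dvdr ?IH // coprimeMl andbb prime_coprime // dvdn_prime2 //.
Qed.

Lemma coprime_primes_prodr (s : seq nat) (m : nat) : all prime s ->
  (forall p, p \in s -> ~~ (p %| m)%N) -> coprime m (\prod_(x <- s) x).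
Proof.
elim: s => [|x s IH] /=; first by rewrite big_nil coprimen1.
move=> /andP[px sp] sm; rewrite big_cons coprimeMr coprime_sym prime_coprime //.
rewrite sm ?mem_head //= IH // => p ps; apply: sm.
by rewrite inE ps orbT.
Qed.

(** * The large sieve at Farey fractions *)

(** Pairs are denominator first, numerator second, for the fractions in [0, 1); denominator 1
    contributes [(1, 0)]. *)
Definition farey_points (Y : nat) : seq (nat * nat) :=
  [seq (k, c) | k <- iota 1 Y, c <- [seq c <- iota 0 k | coprime c k]].

Lemma mem_farey_points Y k c :
  ((k, c) \in farey_points Y) = [&& (0 < k <= Y)%N, (c < k)%N & coprime c k].
Proof.
apply/allpairsPdep/and3P => [[k' [c' []]]|[kY ck cop]].
  rewrite mem_iota mem_filter mem_iota add1n ltnS /= add0n.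
  by move=> kY /andP[cop ck] [-> ->].
exists k, c; split=> //; first by rewrite mem_iota add1n ltnS.
by rewrite mem_filter cop mem_iota.
Qed.

Lemma farey_points_uniq Y : uniq (farey_points Y).
Proof.
apply: allpairs_uniq_dep; first exact: iota_uniq.
  by move=> k _; rewrite filter_uniq ?iota_uniq.
by move=> [k c] [k' c'] _ _ /= [-> ->].
Qed.

Lemma sum_farey_points (V : nmodType) (Y : nat) (F : nat -> nat -> V) :
  \sum_(p <- farey_points Y) F p.1 p.2 =
  \sum_(k <- iota 1 Y) \sum_(c < k | coprime c k) F k c.
Proof.
rewrite big_allpairs_dep /=; apply: eq_bigr => k _.
rewrite big_filter -(big_mkord (fun c => coprime c k)) /index_iota subn0.
by [].
Qed.

Lemma sum_farey_points_eq (V : nmodType) (Y k : nat) (F : nat -> nat -> V) :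
  (0 < k <= Y)%N ->
  \sum_(p <- farey_points Y) (if p.1 == k then F p.1 p.2 else 0) =
  \sum_(c < k | coprime c k) F k c.
Proof.
move=> kY.
rewrite (sum_farey_points Y (fun x c => if x == k then F x c else 0)).
rewrite (bigD1_seq k) ?iota_uniq ?mem_iota ?add1n ?ltnS //= eqxx.
rewrite [X in _ + X]big1 ?addr0 // => x /negbTE xk.
by apply: big1 => c _; rewrite xk.
Qed.

(** The difference is an integer [t] over [k k' <= Y^2], so it is enough that [t != 0]. If [t = 0],
    coprimality makes [k] and [k'] divide each other, and then [c] and [c'] agree modulo [k]. The
    free integer [m] expresses spacing modulo 1. *)
Lemma farey_spacing (R : realType) (Y : nat) (s t : nat * nat) (m : int) :
  s \in farey_points Y -> t \in farey_points Y -> s != t ->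
  (Y ^ 2)%:R^-1 <= `|s.2%:R / s.1%:R - t.2%:R / t.1%:R - m%:~R| :> R.
Proof.
case: s t => [k c] [k' c']; rewrite !mem_farey_points /=.
move=> /and3P[/andP[k0 kY] ck cop] /and3P[/andP[k'0 k'Y] ck' cop'] neq.
have k0R : 0 < k%:R :> R by rewrite ltr0n.
have k'0R : 0 < k'%:R :> R by rewrite ltr0n.
pose t : int := c%:Z * k'%:Z - c'%:Z * k%:Z - m * k%:Z * k'%:Z.
have -> : c%:R / k%:R - c'%:R / k'%:R - m%:~R = t%:~R / (k%:R * k'%:R) :> R.
  rewrite /t !rmorphB !rmorphM /= -!pmulrn.
  by field; rewrite !gt_eqF.
rewrite normrM normfV (gtr0_norm (mulr_gt0 k0R k'0R)).
have t0 : t != 0.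
  apply: contra neq => /eqP t0.
  have tE : c%:Z * k'%:Z = c'%:Z * k%:Z + m * k%:Z * k'%:Z.
    by apply/eqP; rewrite -subr_eq0 -t0 /t; apply/eqP; ring.
  have kk' : (k %| k')%N.
    have : (k%:Z %| k'%:Z * c%:Z)%Z.
      rewrite mulrC tE; apply/dvdzP; exists (c'%:Z + m * k'%:Z); ring.
    by rewrite Gauss_dvdzl ?dvdzE ?coprimezE ?absz_nat // coprime_sym.
  have k'k : (k' %| k)%N.
    have : (k'%:Z %| k%:Z * c'%:Z)%Z.
      apply/dvdzP; exists (c%:Z - m * k%:Z); rewrite mulrBl tE; ring.
    by rewrite Gauss_dvdzl ?dvdzE ?coprimezE ?absz_nat // coprime_sym.
  have kE : k = k' by apply/eqP; rewrite eqn_dvd kk'.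
  have : (k%:Z %| c%:Z - c'%:Z)%Z.
    have kz : k%:Z != 0 by rewrite eqz_nat -lt0n.
    apply/dvdzP; exists m; apply: (mulIf kz); rewrite mulrBl {1}kE tE kE; ring.
  rewrite -eqz_mod_dvd !modz_nat !modn_small ?kE // -?kE // eqz_nat => /eqP ->.
  by [].
have t1 : 1 <= `|t%:~R| :> R.
  by rewrite -intr_norm ler1z; move: t0; rewrite -normr_gt0; lia.
rewrite -[leLHS]mul1r ler_pM ?invr_ge0 // lef_pV2 ?posrE ?mulr_gt0 //.
  by rewrite -natrM ler_nat expnS expn1 leq_mul.
by rewrite ltr0n expn_gt0 (leq_trans k0 kY).
Qed.

(** The additive sieve with [K = Y ^ 2]; starting the window at [n0] multiplies each exponential sum
    by a number of modulus 1. *)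
Lemma large_sieve_farey (R : realType) (Y n : nat) (n0 : int)
    (b : int -> R[i]) : (0 < Y)%N ->
  \sum_(p <- farey_points Y)
    normc (\sum_(j < n.+1) b (n0 + j%:Z) *
             expi ((p.2%:Z * (n0 + j%:Z))%:~R / p.1%:R : R)) ^+ 2
  <= (n + 2 * Y ^ 2)%:R * \sum_(j < n.+1) normc (b (n0 + j%:Z)) ^+ 2.
Proof.
move=> Y0.
have Y20 : (0 < Y ^ 2)%N by rewrite expn_gt0 Y0.
have sp : {in farey_points Y &, forall s t, s != t -> forall m : int,
    (Y ^ 2)%:R^-1 <= `|s.2%:R / s.1%:R - t.2%:R / t.1%:R - m%:~R| :> R}.
  by move=> s t sin tin st m; exact: farey_spacing.
have := large_sieve_nat n (fun j => b (n0 + j%:Z)) Y20 (farey_points_uniq Y) sp.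
apply: le_trans; rewrite le_eqVlt; apply/orP; left; apply/eqP/eq_bigr => p _.
congr (_ ^+ 2); rewrite -[RHS]mul1r -[X in _ = X * _](normc_expi
  (p.2%:R / p.1%:R * n0%:~R : R)) -normcM.
congr normc; rewrite mulr_sumr; apply: eq_bigr => j _.
rewrite mulrCA -expiD; congr (_ * expi _).
rewrite rmorphM rmorphD /= -!pmulrn; ring.
Qed.

(** * The multiplicative large sieve for sifted coefficients *)

Definition char_form (R : realType) (U : seq (nat * (int -> R[i])))
    (n0 : int) (n : nat) (b : int -> R[i]) : R :=
  \sum_(u <- U) normc (\sum_(j < n.+1) b (n0 + j%:Z) * u.2 (n0 + j%:Z)) ^+ 2.

Definition sqr_norm (R : realType) (n0 : int) (n : nat) (b : int -> R[i]) : R :=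
  \sum_(j < n.+1) normc (b (n0 + j%:Z)) ^+ 2.

(** Exchanging the sums produces Gauss sums at level [q r]. Where [b] does not vanish the integer is
    prime to [r], so these are [u * tau * chi] with [|u| = 1] and [|tau|^2 = q]. *)
Lemma normc_farey_transform (R : realType) (chi : int -> R[i]) (q r n : nat)
    (n0 : int) (b : int -> R[i]) :
  (0 < q)%N -> primitive_character q chi -> (0 < r)%N ->
  (forall p, prime p -> ~~ (p * p %| r)%N) -> coprime q r ->
  (forall m, b m != 0 -> coprimez m r%:Z) ->
  normc (\sum_(c < q * r | coprime c (q * r))
    (\sum_(j < n.+1) b (n0 + j%:Z) *
       expi ((c%:Z * (n0 + j%:Z))%:~R / (q * r)%:R : R)) * (chi c%:Z)^*) ^+ 2 =
  q%:R * normc (\sum_(j < n.+1) b (n0 + j%:Z) * chi (n0 + j%:Z)) ^+ 2.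
Proof.
move=> q0 prim r0 sqf qr bsupp; have [chiP _] := prim.
have [u u1 uE] := gauss_sum_mul_sqfree q0 chiP r0 sqf qr.
have -> : \sum_(c < q * r | coprime c (q * r))
    (\sum_(j < n.+1) b (n0 + j%:Z) *
       expi ((c%:Z * (n0 + j%:Z))%:~R / (q * r)%:R : R)) * (chi c%:Z)^* =
    u * gauss_sum chi q 1 * \sum_(j < n.+1) b (n0 + j%:Z) * chi (n0 + j%:Z).
  transitivity (\sum_(j < n.+1) b (n0 + j%:Z) *
                  gauss_sum chi (q * r) (n0 + j%:Z)).
    under eq_bigr do rewrite mulr_suml.
    rewrite exchange_big /=; apply: eq_bigr => j _.
    rewrite mulr_sumr; apply: eq_bigr => c _.
    by rewrite -mulrA (mulrC (expi _)).
  rewrite mulr_sumr; apply: eq_bigr => j _.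
  have [->|bn0] := eqVneq (b (n0 + j%:Z)) 0; first by rewrite !mul0r mulr0.
  by rewrite uE ?bsupp // gauss_sum_primitive //; ring.
rewrite !normcM u1 mul1r exprMn; congr (_ * _).
exact: normc_gauss_sum.
Qed.

(** Selberg's inequality is indexed by pairs of a character and an admissible [r]. The vector [v] of
    such a pair lives on the fractions of denominator [q r]; different vectors are orthogonal and
    the square norm is [phi(q r)]. Applied to the exponential sums [S], it gives each character the
    total weight [q / phi(q)] times the sum of the [1 / phi(r)], which is at least the harmonic
    sum. *)
Lemma large_sieve_sifted (R : realType) (U : seq (nat * (int -> R[i])))
    (Q0 X z n : nat) (n0 : int) (b : int -> R[i]) :
  uniq U ->
  {in U, forall u, (0 < u.1 <= Q0)%N /\ primitive_character u.1 u.2} ->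
  (0 < Q0)%N -> (0 < X)%N -> (z <= X)%N ->
  (forall m p, b m != 0 -> p \in primes_upto z -> ~~ (p%:Z %| m)%Z) ->
  (\sum_(1 <= k < z.+1) k%:R^-1) * char_form U n0 n b
    <= (n + 2 * (Q0 * X) ^ 2)%:R * sqr_norm n0 n b.
Proof.
move=> uU UP Q00 X0 zX bsupp.
pose D := (\prod_(p <- primes_upto z) p)%N.
pose admissible q r := (r %| D)%N && coprime r q.
pose ss := [seq (u, r) | u <- U, r <- [seq r <- iota 1 X | admissible u.1 r]].
pose Y := (Q0 * X)%N.
pose v (s : (nat * (int -> R[i])) * nat) (p : nat * nat) : R[i] :=
  if p.1 == (s.1.1 * s.2)%N then (s.1.2 p.2%:Z)^* else 0.
pose S (p : nat * nat) := \sum_(j < n.+1) b (n0 + j%:Z) *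
             expi ((p.2%:Z * (n0 + j%:Z))%:~R / p.1%:R : R).
pose w (s : (nat * (int -> R[i])) * nat) : R := (totient (s.1.1 * s.2))%:R.
have ssP s : s \in ss -> [/\ s.1 \in U, (0 < s.2 <= X)%N, (s.2 %| D)%N,
    coprime s.1.1 s.2 & (0 < s.1.1 * s.2 <= Y)%N].
  move=> /allpairsPdep[u [r [uin]]]; rewrite mem_filter mem_iota add1n ltnS.
  move=> /andP[/andP[rD rq] rX] -> /=; rewrite coprime_sym; split=> //.
  have [/andP[u0 uQ] _] := UP u uin; case/andP: rX => r0 rX.
  by rewrite muln_gt0 u0 r0 leq_mul.
have uss : uniq ss.
  apply: allpairs_uniq_dep => //.
    by move=> u _; rewrite filter_uniq ?iota_uniq.
  by move=> [u r] [u' r'] _ _ /= [-> ->].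
have prim s : s \in ss -> primitive_character s.1.1 s.1.2.
  by move=> /ssP[sin _ _ _ _]; have [] := UP _ sin.
have innerE s t : s \in ss -> \sum_(p <- farey_points Y) v s p * (v t p)^* =
    if (s.1.1 * s.2 == t.1.1 * t.2)%N then
      \sum_(c < s.1.1 * s.2 | coprime c (s.1.1 * s.2))
         t.1.2 c%:Z * (s.1.2 c%:Z)^* else 0.
  move=> /ssP[_ _ _ _ kY].
  transitivity (\sum_(p <- farey_points Y) (if p.1 == (s.1.1 * s.2)%N then
      (if p.1 == (t.1.1 * t.2)%N then t.1.2 p.2%:Z * (s.1.2 p.2%:Z)^* else 0)
      else 0)).
    apply: eq_bigr => p _; rewrite /v; case: ifP => _; last by rewrite mul0r.
    by case: ifP => _; rewrite ?conjCK ?conjC0 ?mulr0 // mulrC.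
  rewrite (sum_farey_points_eq (fun k c => if k == (t.1.1 * t.2)%N then
     t.1.2 c%:Z * (s.1.2 c%:Z)^* else 0) kY).
  by case: ifP => // _; rewrite big1.
have w_gt0 : {in ss, forall s, 0 < w s}.
  by move=> s /ssP[_ _ _ _ /andP[k0 _]]; rewrite /w ltr0n totient_gt0.
have w_ge : {in ss, forall s,
    \sum_(t <- ss) normc (\sum_(p <- farey_points Y) v s p * (v t p)^*) <= w s}.
  move=> s sin; rewrite (bigD1_seq s) //= innerE // eqxx.
  have [sU _ _ copS /andP[k0 kY]] := ssP s sin.
  have [[/andP[q0 _] _] _] := (UP _ sU, tt).
  have primS := prim s sin; have [chiP _] := primS.
  rewrite [X in _ + X]big1_seq ?addr0.
    rewrite (eq_bigr (fun=> 1)) => [|c cop].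
      by rewrite sum_units_const mulr1 normc_nat.
    have cq : coprimez c%:Z s.1.1%:Z.
      by rewrite coprimezE; apply: coprime_dvdr cop; exact: dvdn_mulr.
    by rewrite conj_eqV ?(normc_dchar q0 chiP) // divff // (dchar_neq0 chiP).
  move=> t /andP[ts tin]; rewrite innerE //.
  case: eqP => [eqk|]; last by rewrite normc0.
  have [tU _ _ copT _] := ssP t tin.
  rewrite eqk (primitive_character_orthogonal (r := t.2) (r' := s.2)
    _ (prim t tin) primS) ?normc0 // -?eqk //.
  (* If the characters and their moduli agree, the common level forces equal cofactors, against
     [t != s]. *)
  move=> [] e1 e2; case/eqP: ts.
  case: s t {sin tin copS copT primS chiP sU tU} eqk e1 e2 k0 kY q0
    => [[q chi] r] [[q' chi'] r'] /= eqk e1 e2 k0 kY q0.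
  rewrite e1 e2; congr (_, _); apply/eqP.
  by rewrite -(eqn_pmul2l q0) eqk e1.
have := selberg_inequality S w_gt0 w_ge.
have Y0 : (0 < Y)%N by rewrite muln_gt0 Q00.
move=> /le_trans /(_ (large_sieve_farey n n0 b Y0)).
rewrite -/(sqr_norm n0 n b).
apply: le_trans.
rewrite big_allpairs_dep /= /char_form mulr_sumr.
rewrite big_seq [leRHS]big_seq; apply: ler_sum => u uin.
have [/andP[q0 qQ] uprim] := UP u uin.
set B := normc _ ^+ 2.
have B0 : 0 <= B by rewrite sqr_ge0.
apply: (@le_trans _ _ ((u.1%:R / (totient u.1)%:R *
    totient_sum R u.1 (primes_upto z) X) * B)).
  by rewrite ler_wpM2r // harmonic_le_totient_sum.
have -> : totient_sum R u.1 (primes_upto z) X =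
   \sum_(r <- [seq r <- iota 1 X | admissible u.1 r]) (totient r)%:R^-1.
  by rewrite big_filter /totient_sum /index_iota subn1.
rewrite mulr_sumr mulr_suml big_seq [leRHS]big_seq.
rewrite le_eqVlt; apply/orP; left; apply/eqP/eq_bigr => r.
rewrite mem_filter mem_iota add1n ltnS => /andP[/andP[rD rq] /andP[r0 rX]].
have kY : (0 < u.1 * r <= Y)%N by rewrite muln_gt0 q0 r0 leq_mul.
have -> : \sum_(p <- farey_points Y) S p * v (u, r) p =
   \sum_(c < u.1 * r | coprime c (u.1 * r))
      S ((u.1 * r)%N, c : nat) * (u.2 c%:Z)^*.
  rewrite -(sum_farey_points_eq (fun k c => S (k, c) * (u.2 c%:Z)^*) kY).
  by apply: eq_bigr => -[k c] _; rewrite /v /=; case: ifP; rewrite ?mulr0.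
rewrite /S /= normc_farey_transform //.
- rewrite /w /= totient_coprime 1?coprime_sym // natrM invfM -/B; ring.
- move=> p pp; apply: contra (sqfree_primes_prod (primes_upto_uniq z)
    (primes_upto_prime z) pp).
  by move=> h; apply: dvdn_trans rD.
- by rewrite coprime_sym.
- move=> m bm; rewrite coprimezE absz_nat; apply: coprime_dvdr rD _.
  apply: coprime_primes_prodr; first exact: primes_upto_prime.
  by move=> p ps; have := bsupp m p bm ps; rewrite dvdzE absz_nat.
Qed.

(** * Splitting the coefficients by their smallest prime factor *)

Lemma normc_sqrD_le (R : realType) (x y : R[i]) :
  normc (x + y) ^+ 2 <= 2 * normc x ^+ 2 + 2 * normc y ^+ 2.
Proof.
apply: (@le_trans _ _ ((normc x + normc y) ^+ 2)).
  by rewrite ler_pXn2r ?nnegrE ?addr_ge0 ?normc_ge0 // le_normcD.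
have := sqr_ge0 (normc x - normc y); rewrite sqrrB sqrrD; lra.
Qed.

Lemma char_formD_le (R : realType) (U : seq (nat * (int -> R[i])))
    (n0 : int) (n : nat) (b b' : int -> R[i]) :
  char_form U n0 n (fun m => b m + b' m)
    <= 2 * char_form U n0 n b + 2 * char_form U n0 n b'.
Proof.
rewrite /char_form !mulr_sumr -big_split /=; apply: ler_sum => u _.
under [X in normc X ^+ 2 <= _]eq_bigr do rewrite mulrDl.
by rewrite big_split /= normc_sqrD_le.
Qed.

Lemma char_form_ge0 (R : realType) (U : seq (nat * (int -> R[i])))
    (n0 : int) (n : nat) (b : int -> R[i]) : 0 <= char_form U n0 n b.
Proof. by apply: sumr_ge0 => u _; rewrite sqr_ge0. Qed.

(** Stated by divisibility so that it applies to all integers; 0 counts as having a small prime as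
    soon as [z >= 2]. *)
Definition has_small_prime (z : nat) (m : int) :=
  has (fun p : nat => (p%:Z %| m)%Z) (primes_upto z).

Section SmallPrimes.
Variables (R : realType) (U : seq (nat * (int -> R[i]))) (n0 : int) (n : nat).
Variables (a : int -> R[i]) (C G : R) (X : nat).
Hypotheses (C_ge0 : 0 <= C) (G_gt0 : 0 < G).
Hypothesis sifted : forall (z : nat) (b : int -> R[i]), (z <= X)%N ->
  (forall m, b m != 0 -> ~~ has_small_prime z m) ->
  ln z.+1%:R * char_form U n0 n b <= C * sqr_norm n0 n b.
Hypothesis mult : forall p : nat, prime p ->
  \sum_(j < n.+1) (if (p%:Z %| n0 + j%:Z)%Z
                   then normc (a (n0 + j%:Z)) ^+ 2 else 0)
    <= p%:R^-1 * (ln p%:R / G) ^+ 2.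

(** At [z = cut x] the sieve supplies [ln z.+1 >= x], whereas the sum over primes costs only
    [ln z <= x], so truncation loses nothing on either side. *)
Let cut (x : R) : nat := Num.truncn (expR x).
Let small (x : R) (m : int) : R[i] :=
  if has_small_prime (cut x) m then a m else 0.

Lemma cut_itv x : (cut x)%:R <= expR x < (cut x).+1%:R.
Proof. by apply: truncn_itv; exact: expR_ge0. Qed.

Lemma cut_gt0 x : 0 <= x -> (0 < cut x)%N.
Proof.
move=> x0; have /andP[_ h] := cut_itv x; rewrite -ltnS -(ltr_nat R).
by apply: le_lt_trans h; rewrite -expR0 ler_expR.
Qed.

Lemma le_ln_cut x : x <= ln (cut x).+1%:R.
Proof.
rewrite -[leLHS]expRK ler_ln ?posrE ?expR_gt0 ?ltr0n //.
by have /andP[_ /ltW] := cut_itv x.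
Qed.

Lemma ln_cut_le x : 0 <= x -> ln (cut x)%:R <= x.
Proof.
move=> x0; rewrite -[leRHS]expRK ler_ln ?posrE ?expR_gt0 ?ltr0n ?cut_gt0 //.
by have /andP[] := cut_itv x.
Qed.

Lemma le_cut x y : x <= y -> (cut x <= cut y)%N.
Proof. by move=> xy; rewrite /cut le_truncn // ler_expR. Qed.

Lemma has_small_prime_le z z' m : (z <= z')%N ->
  has_small_prime z m -> has_small_prime z' m.
Proof.
move=> zz' /hasP[p]; rewrite mem_primes_upto => /andP[pp pz] pm.
by apply/hasP; exists p => //; rewrite mem_primes_upto pp (leq_trans pz).
Qed.

(** A union bound: each integer with a small prime factor is counted once for every such prime, and
    [mult] is summed over the primes. *)
Lemma sqr_norm_small_le (x : R) (b : int -> R[i]) : 0 <= x ->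
  (forall m, normc (b m) ^+ 2 <= normc (small x m) ^+ 2) ->
  sqr_norm n0 n b <= 2 * x ^+ 2 / G ^+ 2.
Proof.
move=> x0 bs.
apply: (@le_trans _ _ (\sum_(p <- primes_upto (cut x)) \sum_(j < n.+1)
   (if (p%:Z %| n0 + j%:Z)%Z then normc (a (n0 + j%:Z)) ^+ 2 else 0))).
  rewrite exchange_big /=; apply: ler_sum => j _.
  apply: (le_trans (bs _)); rewrite /small; case: ifP; last first.
    move=> _; rewrite normc0 expr0n /=; apply: sumr_ge0 => p _.
    by case: ifP => // _; rewrite sqr_ge0.
  move=> /hasP[p pin pm]; rewrite (bigD1_seq p) ?primes_upto_uniq //= pm lerDl.
  by apply: sumr_ge0 => p' _; case: ifP => // _; rewrite sqr_ge0.
apply: (@le_trans _ _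
  (\sum_(p <- primes_upto (cut x)) p%:R^-1 * (ln p%:R / G) ^+ 2)).
  rewrite big_seq [leRHS]big_seq; apply: ler_sum => p.
  by rewrite mem_primes_upto => /andP[pp _]; exact: mult.
under eq_bigr do rewrite exprMn exprVn mulrA.
rewrite -mulr_suml ler_wpM2r ?invr_ge0 ?sqr_ge0 //.
apply: (le_trans (sum_ln_prime_sqr_le R (cut_gt0 x0))).
rewrite ler_pM2l // ler_pXn2r ?nnegrE ?ln_nat_ge0 //.
exact: ln_cut_le.
Qed.

(** Write [T(x)] for the left side and [y = x / 4]. The integers with a prime factor up to [e^x] but
    none up to [e^y] are sieved at [e^y]; their mass [2 x^2 / G^2] divided by [y] gives
    [8 x C / G^2]. Hence [T(x) <= 2 T(x/4) + 16 x C / G^2], and 32 solves [c = c/2 + 16]. The index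
    [k] bounds the number of blocks. *)
Lemma char_form_small_le (k : nat) (x : R) : 0 <= x -> (cut x <= X)%N ->
  x < 4 ^+ k * ln 2 -> char_form U n0 n (small x) <= 32 * x * C / G ^+ 2.
Proof.
have G2 : 0 < G ^+ 2 by rewrite exprn_gt0.
elim: k x => [|k IH] x x0 xX xk.
  (* Here [e^x < 2], so there is no prime up to the cut. *)
  have -> : char_form U n0 n (small x) = 0.
    apply: big1 => u _; rewrite big1 ?normc0 ?expr0n //= => j _.
    rewrite /small; case: ifP => [/hasP[p]|]; last by rewrite mul0r.
    rewrite mem_primes_upto => /andP[pp pz] _.
    suff : (cut x < 2)%N by have := prime_gt1 pp; lia.
    rewrite -(ltr_nat R); have /andP[h _] := cut_itv x; apply: (le_lt_trans h).
    by rewrite -[ltRHS]lnK ?posrE // ltr_expR; move: xk; rewrite expr0 mul1r.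
  by rewrite divr_ge0 ?mulr_ge0 // ltW.
have [x2|x2] := ltP x (4 ^+ k * ln 2); first exact: IH.
have {x0}x0 : 0 < x.
  by apply: lt_le_trans x2; rewrite mulr_gt0 ?exprn_gt0 // ln_gt0 // ltr1n.
pose y := x / 4.
have y0 : 0 < y by rewrite divr_gt0.
have yx : y <= x by rewrite /y; lra.
have cutyx : (cut y <= cut x)%N by exact: le_cut.
pose b m := if has_small_prime (cut x) m && ~~ has_small_prime (cut y) m
            then a m else 0.
have smallE : small x = (fun m => small y m + b m).
  apply/funext => m; rewrite /small /b.
  have [hy|hy] := boolP (has_small_prime (cut y) m).
    by rewrite (has_small_prime_le cutyx hy) addr0.
  by rewrite add0r andbT.
have Ty : char_form U n0 n (small y) <= 32 * y * C / G ^+ 2.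
  apply: IH; [exact: ltW|exact: leq_trans xX|].
  by move: xk; rewrite /y exprS -mulrA; lra.
have Tb : y * char_form U n0 n b <= C * (2 * x ^+ 2 / G ^+ 2).
  apply: (@le_trans _ _ (ln (cut y).+1%:R * char_form U n0 n b)).
    by rewrite ler_wpM2r ?char_form_ge0 // le_ln_cut.
  apply: (@le_trans _ _ (C * sqr_norm n0 n b)).
    apply: sifted; first exact: leq_trans xX.
    by move=> m; rewrite /b; case: ifP => [/andP[]|]; rewrite ?eqxx.
  rewrite ler_wpM2l // sqr_norm_small_le ?ltW // => m.
  rewrite /b /small; case: has_small_prime => //=.
  by case: ifP => // _; rewrite normc0 expr0n sqr_ge0.
have {}Tb : char_form U n0 n b <= 8 * x * C / G ^+ 2.
  rewrite -(ler_pM2l y0) (le_trans Tb) // /y le_eqVlt; apply/orP; left.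
  by apply/eqP; field; rewrite gt_eqF.
rewrite smallE; apply: (le_trans (char_formD_le _ _ _ _ _)).
apply: (@le_trans _ _ (2 * (32 * y * C / G ^+ 2) + 2 * (8 * x * C / G ^+ 2))).
  by rewrite lerD // ler_pM2l.
by rewrite /y le_eqVlt; apply/orP; left; apply/eqP; field; rewrite gt_eqF.
Qed.

(** The part without prime factors up to [e^x] costs [C / x], the rest is bounded by the preceding
    lemma, and the last split doubles both. *)
Lemma char_form_le (x : R) : 0 < x -> (cut x <= X)%N ->
  sqr_norm n0 n a <= 1 ->
  char_form U n0 n a <= C * (2 / x + 64 * x / G ^+ 2).
Proof.
move=> x0 xX a1.
pose b m := if ~~ has_small_prime (cut x) m then a m else 0.
have aE : a = (fun m => small x m + b m).
  apply/funext => m; rewrite /small /b.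
  by case: has_small_prime; rewrite /= ?addr0 ?add0r.
have [k xk] : exists k, x < 4 ^+ k * ln 2.
  have l2 : 0 < ln 2 :> R by rewrite ln_gt0 // ltr1n.
  pose k := (Num.truncn (x / ln 2)).+1; exists k.
  rewrite -ltr_pdivrMr //.
  have /andP[_ h] : (Num.truncn (x / ln 2))%:R <= x / ln 2 < k%:R.
    by apply: truncn_itv; rewrite divr_ge0 ?ltW.
  apply: (lt_le_trans h); rewrite -natrX ler_nat ltnW // ltn_expl //.
have Ts := char_form_small_le (ltW x0) xX xk.
have Tb : x * char_form U n0 n b <= C.
  apply: (@le_trans _ _ (ln (cut x).+1%:R * char_form U n0 n b)).
    by rewrite ler_wpM2r ?char_form_ge0 // le_ln_cut.
  apply: (@le_trans _ _ (C * sqr_norm n0 n b)).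
    apply: sifted => // m; rewrite /b.
    by case: ifP => //; rewrite ?eqxx.
  rewrite -[leRHS]mulr1 ler_wpM2l //; apply: le_trans a1.
  apply: ler_sum => j _; rewrite /b; case: ifP => // _.
  by rewrite normc0 expr0n sqr_ge0.
rewrite {1}aE; apply: (le_trans (char_formD_le _ _ _ _ _)).
have {}Tb : char_form U n0 n b <= C / x by rewrite ler_pdivlMr // mulrC.
apply: (@le_trans _ _ (2 * (32 * x * C / G ^+ 2) + 2 * (C / x))).
  by rewrite lerD // ler_pM2l.
by rewrite le_eqVlt; apply/orP; left; apply/eqP; field; rewrite !gt_eqF.
Qed.

End SmallPrimes.

(** * Reduction to a finite window and the numerical constants *)

(** The bounded support rules out the default value 0 that a set sum takes on an infinite
    support. *)
Lemma fsum_int_interval (V : nmodType) (A : set int) (F : int -> V)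
    (n0 : int) (n : nat) :
  (forall m, F m != 0 -> exists2 j, (j < n)%N & m = n0 + j%:Z) ->
  \sum_(m \in A) F m =
  \sum_(j < n) (if n0 + j%:Z \in A then F (n0 + j%:Z) else 0).
Proof.
move=> suppF; rewrite fsbig_mkcond.
pose r := [seq n0 + j%:Z | j <- iota 0 n].
have ur : uniq r.
  rewrite map_inj_uniq ?iota_uniq // => i j /addrI h.
  by apply/eqP; rewrite -eqz_nat h.
rewrite -(@fsbig_widen _ _ _ _ [set` r]) //; last first.
  move=> m [_ /= mr]; rewrite /patch; case: ifP => // _.
  apply/eqP/negPn/negP => /suppF[j jn mE]; apply: mr.
  by apply/mapP; exists j; rewrite // mem_iota.
rewrite -fsbig_seq // /r big_map -(big_mkord xpredT
  (fun j => if n0 + j%:Z \in A then F (n0 + j%:Z) else 0)).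
by rewrite /index_iota subn0; apply: eq_bigr => j _; rewrite /patch.
Qed.

(** Here [D] bounds the square of the largest modulus. From [L > 19], [e^(L/3) >= 1 + L/3 >= 22/3],
    and [(22/3)^2 > 53], so the first factor is at most [55/53 N]. The second is at most
    [(12 + 32/3) / L = 68 / (3 L)], and [55/53 * 68/3 < 24]. *)
Lemma ln_ratio_bound (R : realType) (N L D : R) : 19 < L ->
  0 <= N -> L <= ln N -> 0 <= D -> D <= N * expR (- (L * (2 / 3))) ->
  (N + 2 * D) * (2 / (L / 6) + 64 * (L / 6) / ln N ^+ 2) <= 24 * N * L^-1.
Proof.
move=> L19 N0 LN D0 DN.
have L0 : 0 < L by apply: lt_trans L19.
have D53 : D <= N / 53.
  apply: (le_trans DN); rewrite ler_wpM2l //.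
  have -> : - (L * (2 / 3)) = - (L / 3) + - (L / 3) :> R by ring.
  rewrite expRD expRN -invfM lef_pV2 ?posrE ?mulr_gt0 ?expR_gt0 //.
  have e1 : 22 / 3 <= expR (L / 3).
    by apply: le_trans (expR_ge1Dx _); lra.
  apply: (@le_trans _ _ ((22 / 3) * (22 / 3))); first by lra.
  by rewrite ler_pM.
have h : 64 * (L / 6) / ln N ^+ 2 <= 64 * (L / 6) / L ^+ 2.
  rewrite ler_pM2l; last by rewrite mulr_gt0 // divr_gt0.
  rewrite lef_pV2 ?posrE ?exprn_gt0 ?(lt_le_trans L0 LN) //.
  by rewrite ler_pXn2r ?nnegrE ?(ltW L0) ?(le_trans (ltW L0) LN).
apply: (@le_trans _ _
  ((N + 2 * (N / 53)) * (2 / (L / 6) + 64 * (L / 6) / L ^+ 2))).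
  apply: ler_pM; [by lra| |by lra|by rewrite lerD2l].
  have L6 : 0 <= L / 6 by rewrite divr_ge0 // ltW.
  apply: addr_ge0; first exact: divr_ge0.
  by apply: divr_ge0; [exact: mulr_ge0|exact: sqr_ge0].
have -> : (N + 2 * (N / 53)) * (2 / (L / 6) + 64 * (L / 6) / L ^+ 2) =
    (55 / 53 * (68 / 3)) * N * L^-1 by field; rewrite gt_eqF.
by rewrite ler_pM2r ?invr_gt0 // ler_wpM2r //; lra.
Qed.

Theorem theorem2p1 (R : realType) (M N Q : R) (a : int -> R[i])
  (supp_a : forall n : int, a n != 0 -> M < n%:~R < M + N)
  (norm_a : \sum_(n \in [set: int]) Normc.normc (a n) ^+ 2 <= 1)
  (mult_a : forall p : nat, prime p ->
     \sum_(n \in [set n : int | (p%:Z %| n)%Z]) Normc.normc (a n) ^+ 2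
       <= p%:R^-1 * (ln p%:R / ln N) ^+ 2)
  (Q_gt0 : 0 < Q) (leQN : 8 * Q ^+ 2 <= N) :
  \sum_(1 <= q < (Num.truncn Q).+1)
    \sum_(chi \in [set chi : int -> R[i] | primitive_character q chi])
      Normc.normc (\sum_(n \in [set n : int | M < n%:~R <= M + N])
                     a n * chi n) ^+ 2
  <= 24 * N * (ln (N / Q ^+ 2))^-1.
Proof.
have Q2 : 0 < Q ^+ 2 by rewrite exprn_gt0.
have N_gt0 : 0 < N by apply: lt_le_trans leQN; rewrite mulr_gt0.
have ratio8 : 8 <= N / Q ^+ 2 by rewrite ler_pdivlMr.
set L := ln (N / Q ^+ 2).
have L_gt0 : 0 < L by rewrite ln_gt0 // (lt_le_trans _ ratio8) // ltr1n.
(* For [Q < 1] there are no moduli; otherwise [Q >= 1] will give [L <= ln N]. *)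
have [Q1|Q1] := ltP Q 1.
  rewrite big_geq; last first.
    have /andP[h _] := truncn_itv (ltW Q_gt0).
    by rewrite -(ltr_nat R) (le_lt_trans h).
  by rewrite mulr_ge0 ?mulr_ge0 ?invr_ge0 // ltW.
pose Q0 := Num.truncn Q.
have /andP[Q0Q QQ0] : Q0%:R <= Q < Q0.+1%:R by apply: truncn_itv; rewrite ltW.
have Q00 : (0 < Q0)%N by rewrite -ltnS -(ltr_nat R) (le_lt_trans Q1).
(* [n0] is the least integer above [M], and the [n.+1] integers starting there contain the support
   of [a]. The sieve for [n.+1] coefficients has the constant [n <= N], so rounding costs
   nothing. *)
pose n0 : int := Num.floor M + 1.
pose n := Num.truncn N.
have /andP[nN Nn] : n%:R <= N < n.+1%:R by apply: truncn_itv; rewrite ltW.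
have suppj m : a m != 0 -> exists2 j, (j < n.+1)%N & m = n0 + j%:Z.
  move=> /supp_a/andP[Mm mMN].
  have n0m : n0 <= m by rewrite /n0 lezD1 floor_lt_int.
  exists `|m - n0|%N; last by rewrite gez0_abs ?subr_ge0 //; ring.
  have n0M : M < n0%:~R by exact: floorD1_gt.
  rewrite -(ltr_nat R); apply: le_lt_trans Nn.
  rewrite -[X in X <= _]/(`|m - n0|%N%:Z%:~R) gez0_abs ?subr_ge0 // rmorphB /=.
  lra.
have suppF (f : int -> R) : (forall m, a m = 0 -> f m = 0) ->
    forall m, f m != 0 -> exists2 j, (j < n.+1)%N & m = n0 + j%:Z.
  by move=> fa m fm; apply: suppj; apply: contra fm => /eqP/fa ->.
have sq0 m : a m = 0 -> normc (a m) ^+ 2 = 0.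
  by move=> ->; rewrite normc0 expr0n.
have sqa : sqr_norm n0 n a <= 1.
  apply: le_trans norm_a; rewrite (fsum_int_interval _ (suppF _ sq0)).
  rewrite le_eqVlt; apply/orP; left; apply/eqP/eq_bigr => j _.
  by rewrite in_setT.
have mult p : prime p -> \sum_(j < n.+1) (if (p%:Z %| n0 + j%:Z)%Z
      then normc (a (n0 + j%:Z)) ^+ 2 else 0)
    <= p%:R^-1 * (ln p%:R / ln N) ^+ 2.
  move=> pp; apply: le_trans (mult_a p pp).
  rewrite (fsum_int_interval _ (suppF _ sq0)).
  rewrite le_eqVlt; apply/orP; left; apply/eqP/eq_bigr => j _.
  by congr (if _ then _ else _); apply/idP/idP; rewrite inE.
pose prim q := [set chi : int -> R[i] | primitive_character q chi].
have finprim q : (0 < q)%N -> finite_set (prim q).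
  move=> q0; apply: sub_finite_set (finite_dirichlet_character R q0).
  by move=> chi [].
pose U := [seq (q, chi) | q <- iota 1 Q0, 
               chi <- finmap.enum_fset (fset_set (prim q))].
have uU : uniq U.
  apply: allpairs_uniq_dep; first exact: iota_uniq.
    by move=> q _; exact: finmap.fset_uniq.
  by move=> [q chi] [q' chi'] _ _ /= [-> ->].
have UP : {in U, forall u, (0 < u.1 <= Q0)%N /\ primitive_character u.1 u.2}.
  move=> _ /allpairsPdep[q [chi [qin chiin ->]]] /=.
  move: qin; rewrite mem_iota add1n ltnS => qQ; split=> //.
  have q0 : (0 < q)%N by case/andP: qQ.
  by have := in_fset_set (finprim q q0) chi; rewrite chiin => /esym/set_mem.
set LHS := (X in X <= _).
have -> : LHS = char_form U n0 n a.
  rewrite /LHS /char_form big_allpairs_dep /= /index_iota subn1 /=.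
  rewrite big_seq [RHS]big_seq; apply: eq_bigr => q.
  rewrite mem_iota => /andP[q0 _]; rewrite fsbig_finite; last exact: finprim.
  apply: eq_bigr => chi _; congr (normc _ ^+ 2).
  rewrite (@fsum_int_interval _ _ (fun m => a m * chi m) n0 n.+1); last first.
    move=> m; rewrite mulf_eq0 negb_or => /andP[am _]; exact: suppj.
  (* Positions of the window outside the range of summation carry the coefficient 0. *)
  apply: eq_bigr => j _; case: ifP => // /negbT; rewrite notin_setE /= => out.
  suff -> : a (n0 + j%:Z) = 0 by rewrite mul0r.
  apply/eqP/negPn/negP => /supp_a/andP[h1 h2]; apply: out.
  by rewrite h1 ltW.
have lnN : L <= ln N.
  rewrite ler_ln ?posrE ?divr_gt0 // ler_pdivrMr //.
  by apply: ler_peMr; [exact: ltW|exact: exprn_ege1].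
have QR : Q0%:R ^+ 2 <= Q ^+ 2 by rewrite ler_pXn2r ?nnegrE ?(ltW Q_gt0).
(* Below the threshold, [8 Q^2 <= N] gives [N + 2 Q^2 <= 5/4 N], and [5/4 * 19 < 24]. *)
have [L19|L19] := leP L 19.
  have none m p : a m != 0 -> p \in primes_upto 1 -> ~~ (p%:Z %| m)%Z.
    rewrite mem_primes_upto => _ /andP[/prime_gt1 p1 p2].
    by have := leq_trans p1 p2.
  (* With [X = z = 1] there is no prime to sieve by and the harmonic sum is 1: this is the plain
     multiplicative large sieve. *)
  have := @large_sieve_sifted R U Q0 1 1 n n0 a uU UP Q00 isT isT none.
  rewrite big_nat1 invr1 mul1r => /le_trans; apply.
  have A0 : 0 <= sqr_norm n0 n a by apply: sumr_ge0 => j _; rewrite sqr_ge0.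
  apply: (@le_trans _ _ (N + 2 * Q ^+ 2)).
    apply: (@le_trans _ _ (n + 2 * (Q0 * 1) ^ 2)%:R).
      by rewrite -[leRHS]mulr1 ler_wpM2l.
    by rewrite muln1 natrD natrM natrX lerD // ler_pM2l.
  rewrite -/L ler_pdivlMr //; apply: (@le_trans _ _ ((N + 2 * Q ^+ 2) * 19)).
    by rewrite ler_wpM2l // addr_ge0 ?mulr_ge0 ?ltW.
  by lra.
pose x := L / 6; pose X := Num.truncn (expR x).
have x0 : 0 < x by rewrite divr_gt0.
have X0 : (0 < X)%N by exact: cut_gt0 (ltW x0).
pose C : R := (n + 2 * (Q0 * X) ^ 2)%:R.
have sifted z b : (z <= X)%N ->
    (forall m, b m != 0 -> ~~ has_small_prime z m) ->
    ln z.+1%:R * char_form U n0 n b <= C * sqr_norm n0 n b.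
  move=> zX bz; apply: (@le_trans _ _ ((\sum_(1 <= k < z.+1) k%:R^-1) *
      char_form U n0 n b)).
    by rewrite ler_wpM2r ?char_form_ge0 // ln_le_harmonic.
  apply: large_sieve_sifted => // m p bm pz.
  by apply/negP => pm; case/negP: (bz m bm); apply/hasP; exists p.
have := @char_form_le R U n0 n a C (ln N) X _ (lt_le_trans L_gt0 lnN) sifted
  mult x x0 (leqnn _) sqa.
rewrite ler0n => /(_ isT) /le_trans; apply.
apply: le_trans (ln_ratio_bound L19 (ltW N_gt0) lnN
  (D := ((Q0 * X) ^ 2)%:R) _ _) => //.
  rewrite /C natrD natrM ler_wpM2r //; last by rewrite lerD2r.
  have x0' := ltW x0.
  apply: addr_ge0; first exact: divr_ge0.
  by apply: divr_ge0; [exact: mulr_ge0|exact: sqr_ge0].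
have XE : X%:R <= expR x by have /andP[] := @truncn_itv R (expR x) (expR_ge0 x).
(* Since [X <= e^x] and [x = L / 6], the square of the largest modulus is at most
   [Q^2 e^(L/3) = N e^(-2 L/3)]. *)
apply: (@le_trans _ _ (Q ^+ 2 * expR x ^+ 2)).
  rewrite natrX natrM exprMn ler_pM ?sqr_ge0 //.
  by rewrite ler_pXn2r ?nnegrE ?expR_ge0.
have -> : N = Q ^+ 2 * expR L.
  by rewrite /L lnK ?posrE ?divr_gt0 // mulrC divfK ?gt_eqF.
rewrite -mulrA ler_pM2l // -expRD expr2 -expRD ler_expR /x; lra.
Qed.
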